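(* Let $K$ be a compact line, $L$ be a compact Hausdorff space that is hereditarily paracompact and scattered, and $\phi:K\to L$ be a continuous surjection. Then, for any $\varepsilon>0$, the subspace $\phi^*C(L)$ has the $c_0$-extension property with constant $2+\varepsilon$ in $C(K)$.
   Context: All Banach spaces are real. A compact line is a linearly ordered set which is compact in the order topology. A topological space is hereditarily paracompact if each of its subspaces is paracompact, and scattered if each of its nonempty subspaces has an isolated point. For a compact Hausdorff space $K$, $C(K)$ denotes the Banach space of real-valued continuous functions on $K$ with the supremum norm. For a continuous map $\phi:K\to L$ between compact Hausdorff spaces, $\phi^*:C(L)\to C(K)$ is the composition map $f\mapsto f\circ\phi$, and $\phi^*C(L)$ denotes its range (when $\phi$ is onto, $\phi^*$ is an isometric embedding, so the range is a closed subspace). Given $\lambda\ge1$, a closed subspace $Y$ of a Banach space $X$ has the $c_0$-extension property with constant $\lambda$ in $X$ if every bounded linear operator $T:Y\to c_0$ admits a bounded linear extension $T':X\to c_0$ with $\Vert T'\Vert\le\lambda\Vert T\Vert$. *)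

(* Defs.v *)
From HB Require Import structures.
From mathcomp Require Import all_boot all_order all_algebra.
From mathcomp Require Import ring lra.
From mathcomp Require Import all_classical all_reals all_analysis.

Set Implicit Arguments.
Unset Strict Implicit.
Unset Printing Implicit Defensive.

Import Order.TTheory GRing.Theory Num.Theory.
Import numFieldNormedType.Exports.

Local Open Scope classical_set_scope.
Local Open Scope ring_scope.

Definition locally_finite (T : topologicalType) (V : set (set T)) :=
  forall x : T,
    exists2 W, nbhs x W & finite_set [set B | V B /\ B `&` W !=set0].

(* The Hausdorff axiom, which some authors include, is not part of this
   definition. *)
Definition paracompact (T : topologicalType) :=
  forall U : set (set T),
    (forall A, U A -> open A) -> \bigcup_(A in U) A = [set: T] ->
    exists V : set (set T),
      [/\ forall B, V B -> open B,
          \bigcup_(B in V) B = [set: T],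
          forall B, V B -> exists2 A, U A & B `<=` A
        & locally_finite V].

Definition hereditarily_paracompact (T : topologicalType) :=
  forall A : set T, paracompact (set_type A).

Definition scattered (T : topologicalType) :=
  forall A : set T, A !=set0 -> isolated A !=set0.

Section SupNorm.
Context (R : realType).

(* The value is meaningful for bounded f only; it is 0 if T is empty. *)
Definition supnorm (T : Type) (f : T -> R) : R := sup (range (fun x => `|f x|)).

Definition bddfun (T : Type) (f : T -> R) := has_ubound (range (fun x => `|f x|)).

Context (T : Type).
Implicit Types f g : T -> R.

Lemma bddfunP f : bddfun f <-> exists M, forall x, `|f x| <= M.
Proof.
split=> -[M fM]; exists M; last by move=> _ [x _ <-].
by move=> x; apply: fM; exists x.
Qed.

Lemma supnorm_ub f x : bddfun f -> `|f x| <= supnorm f.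
Proof. by move=> bf; apply: ub_le_sup => //; exists x. Qed.

Lemma supnorm_le f M : 0 <= M -> (forall x, `|f x| <= M) -> supnorm f <= M.
Proof.
move=> M0 fM; rewrite /supnorm.
have [[x _]|T0] := pselect ([set: T] !=set0).
  by apply: ge_sup => [|_ [y _ <-]//]; exists `|f x|; exists x.
suff -> : range (fun x => `|f x|) = set0 by rewrite sup0.
by rewrite -subset0 => y [x _ _]; apply: T0; exists x.
Qed.

Lemma supnorm_ge0 f : 0 <= supnorm f.
Proof.
have [[[y [x _ _]] bf]|ns] := pselect (has_sup (range (fun x => `|f x|))).
  by rewrite (le_trans (normr_ge0 (f x)))// supnorm_ub.
by rewrite /supnorm sup_out.
Qed.

Lemma supnormD f g : bddfun f -> bddfun g ->
  supnorm (f \+ g) <= supnorm f + supnorm g.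
Proof.
move=> bf bg; apply: supnorm_le => [|x]; first by rewrite addr_ge0 ?supnorm_ge0.
by rewrite (le_trans (ler_normD _ _))// lerD ?supnorm_ub.
Qed.

Lemma supnormZ (a : R) f : bddfun f ->
  supnorm (fun x => a * f x) = `|a| * supnorm f.
Proof.
move=> bf; apply/le_anti/andP; split.
  apply: supnorm_le => [|x]; first by rewrite mulr_ge0 ?supnorm_ge0.
  by rewrite normrM ler_wpM2l ?supnorm_ub.
have [->|a0] := eqVneq a 0; first by rewrite normr0 mul0r supnorm_ge0.
have ba : bddfun (fun x => a * f x).
  case/bddfunP: bf => M fM; apply/bddfunP; exists (`|a| * M) => x.
  by rewrite normrM ler_wpM2l.
rewrite mulrC -ler_pdivlMr ?normr_gt0//; apply: supnorm_le => [|x].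
  by rewrite divr_ge0 ?supnorm_ge0.
rewrite ler_pdivlMr ?normr_gt0// mulrC -normrM.
exact: (supnorm_ub x ba).
Qed.

Lemma supnorm0_eq0 f : bddfun f -> supnorm f = 0 -> forall x, f x = 0.
Proof.
move=> bf f0 x; apply/eqP; rewrite -normr_eq0 eq_le normr_ge0 andbT -f0.
exact: supnorm_ub.
Qed.

End SupNorm.

(* C(K). The proof of compactness is a parameter of the type because the
   supremum norm is a norm only for bounded functions. *)
Definition Cspace (R : realType) (K : topologicalType)
  (cK : compact [set: K]) : Type := continuousType K R.

Section Cspace.
Context (R : realType) (K : topologicalType) (cK : compact [set: K]).
Local Notation CK := (Cspace R cK).

HB.instance Definition _ := Choice.on CK.

Definition Cfun (f : CK) : K -> R := (f : continuousType K R).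

Lemma Cfun_continuous (f : CK) : continuous (Cfun f).
Proof. exact: cts_fun. Qed.
Arguments Cfun_continuous f : clear implicits.

Definition mkC (f : K -> R) (cf : continuous f) : CK := mkcts cf.

Lemma mkCE f (cf : continuous f) : Cfun (mkC cf) = f. Proof. by []. Qed.

Lemma CspaceP (f g : CK) : Cfun f =1 Cfun g -> f = g.
Proof. by move=> fg; apply/continuousEP. Qed.

Lemma Cfun_bdd (f : CK) : bddfun (Cfun f).
Proof.
have /compact_bounded[M [_ fM]] : compact (Cfun f @` [set: K]).
  by apply: continuous_compact cK; exact/continuous_subspaceT/Cfun_continuous.
apply/bddfunP; exists (`|M| + 1) => x; apply: fM; last by exists x.
by rewrite (le_lt_trans (ler_norm _))// ltrDl.
Qed.

Definition Czero : CK := mkC (fun x => @cst_continuous K R 0 x).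
Definition Copp (f : CK) : CK :=
  mkC (fun x => continuousN (Cfun_continuous f x)).
Definition Cadd (f g : CK) : CK :=
  mkC (fun x => continuousD (Cfun_continuous f x) (Cfun_continuous g x)).
Definition Cscale (a : R) (f : CK) : CK :=
  mkC (fun x => continuousM (@cst_continuous K R a x) (Cfun_continuous f x)).

Lemma CaddA : associative Cadd.
Proof. by move=> f g h; apply: CspaceP => x; exact: addrA. Qed.
Lemma CaddC : commutative Cadd.
Proof. by move=> f g; apply: CspaceP => x; exact: addrC. Qed.
Lemma Cadd0 : left_id Czero Cadd.
Proof. by move=> f; apply: CspaceP => x; exact: add0r. Qed.
Lemma CaddN : left_inverse Czero Copp Cadd.
Proof. by move=> f; apply: CspaceP => x; exact: addNr. Qed.

HB.instance Definition _ := GRing.isZmodule.Build CK CaddA CaddC Cadd0 CaddN.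

Lemma CscaleA a b (f : CK) : Cscale a (Cscale b f) = Cscale (a * b) f.
Proof. by apply: CspaceP => x; exact: mulrA. Qed.
Lemma Cscale1 : left_id 1 Cscale.
Proof. by move=> f; apply: CspaceP => x; exact: mul1r. Qed.
Lemma CscaleDr : right_distributive Cscale +%R.
Proof. by move=> a f g; apply: CspaceP => x; exact: mulrDr. Qed.
Lemma CscaleDl (f : CK) : {morph Cscale^~ f : a b / a + b}.
Proof. by move=> a b; apply: CspaceP => x; exact: mulrDl. Qed.

HB.instance Definition _ :=
  GRing.Zmodule_isLmodule.Build R CK CscaleA Cscale1 CscaleDr CscaleDl.

Definition Cnorm (f : CK) : R := supnorm (Cfun f).

Lemma CnormD (f g : CK) : Cnorm (f + g) <= Cnorm f + Cnorm g.
Proof. exact: supnormD (Cfun_bdd f) (Cfun_bdd g). Qed.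
Lemma CnormZ a (f : CK) : Cnorm (a *: f) = `|a| * Cnorm f.
Proof. exact: supnormZ (Cfun_bdd f). Qed.
Lemma Cnorm_eq0 (f : CK) : Cnorm f = 0 -> f = 0.
Proof. by move=> f0; apply: CspaceP => x; exact: (supnorm0_eq0 (Cfun_bdd f)). Qed.

HB.instance Definition _ := Lmodule_isNormed.Build R CK CnormD CnormZ Cnorm_eq0.

Lemma CnormE (f : CK) : `|f| = supnorm (Cfun f). Proof. by []. Qed.

Lemma Cfun_le (f : CK) x : `|Cfun f x| <= `|f|.
Proof. exact: supnorm_ub (Cfun_bdd f). Qed.

Lemma CfunD (f g : CK) x : Cfun (f + g) x = Cfun f x + Cfun g x.
Proof. by []. Qed.
Lemma CfunN (f : CK) x : Cfun (- f) x = - Cfun f x.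
Proof. by []. Qed.
Lemma CfunB (f g : CK) x : Cfun (f - g) x = Cfun f x - Cfun g x.
Proof. by []. Qed.
Lemma CfunZ a (f : CK) x : Cfun (a *: f) x = a * Cfun f x.
Proof. by []. Qed.

Lemma uniform_continuous_limit (g : K -> R) :
  (forall e, 0 < e -> exists f : CK, forall x, `|g x - Cfun f x| <= e) ->
  continuous g.
Proof.
move=> H x; apply/cvgrPdist_le => e e0.
have e30 : 0 < e / 3 by rewrite divr_gt0.
have [f fg] := H _ e30.
have /cvgrPdist_le/(_ _ e30) := @Cfun_continuous f x.
apply: filterS => y fxy.
have -> : g x - g y = (g x - Cfun f x) + (Cfun f x - Cfun f y)
    - (g y - Cfun f y) by ring.
have -> : e = e / 3 + e / 3 + e / 3 by field.
by rewrite (le_trans (ler_normB _ _))// lerD// (le_trans (ler_normD _ _))// lerD.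
Qed.

Lemma Cspace_complete (F : set_system CK) :
  ProperFilter F -> cauchy F -> cvg F.
Proof.
move=> FF /cauchyP Fc.
have Fball e : 0 < e -> exists f : CK, F [set h | `|f - h| <= e].
  move=> e0; have [f Ff] := Fc e e0; exists f.
  by apply: filterS Ff => h; rewrite -ball_normE => /ltW.
have pc (x : K) : cvg ((fun f : CK => Cfun f x) @ F).
  apply: cauchy_cvg; apply: cauchy_exP => e e0.
  have [f Ff] := Fball (e / 2) (divr_gt0 e0 (ltr0n _ 2)).
  exists (Cfun f x).
  suff : F [set h : CK | ball (Cfun f x) e (Cfun h x)] by [].
  apply: filterS Ff => h fh /=.
  rewrite -ball_normE; change (`|Cfun (f - h) x| < e).
  rewrite (le_lt_trans (Cfun_le _ _))//.
  by rewrite (le_lt_trans fh)// ltr_pdivrMr// ltr_pMr// ltr1n.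
pose g x := lim ((fun f : CK => Cfun f x) @ F).
have gF x e : 0 < e -> F [set h | `|g x - Cfun h x| <= e].
  by move=> e0; have /cvgrPdist_le/(_ e e0) := pc x.
have gle e (f : CK) : F [set h | `|f - h| <= e] ->
    forall x, `|g x - Cfun f x| <= e.
  move=> Ff x; apply/ler_addgt0Pr => d d0.
  have [h [fh gh]] := filter_ex (filterI Ff (gF x d d0)).
  rewrite (_ : g x - _ = (g x - Cfun h x) - (Cfun f x - Cfun h x)); last by ring.
  rewrite (le_trans (ler_normB _ _))// addrC lerD//.
  exact: le_trans (Cfun_le (f - h) x) fh.
have cg : continuous g.
  apply: uniform_continuous_limit => e e0.
  by have [f Ff] := Fball e e0; exists f; exact: gle.
apply/cvg_ex; exists (mkC cg); apply/cvgrPdist_le => e e0.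
have [f Ff] := Fball (e / 2) (divr_gt0 e0 (ltr0n _ 2)).
apply: filterS (Ff) => h fh.
rewrite -(subrKA f) [leRHS]splitr (le_trans (ler_normD _ _))// lerD//.
rewrite CnormE; apply: supnorm_le => [|x]; first by rewrite divr_ge0// ltW.
exact: gle.
Qed.

HB.instance Definition _ := Uniform_isComplete.Build CK Cspace_complete.

End Cspace.
Arguments Cfun_le {R K cK} f x.

Section c0space.
Context (R : realType).

Definition null_seq : {pred R^nat} := [pred u : R^nat | `[< u @ \oo --> (0 : R) >]].

Lemma null_seq_submod_closed : submod_closed null_seq.
Proof.
split; first by apply/asboolP; exact: cvg_cst.
move=> a u v /asboolP u0 /asboolP v0; apply/asboolP.
have : (fun n => a * u n) + v @ \oo --> a * 0 + 0.
  by apply: cvgD => //; apply: cvgM => //; exact: cvg_cst.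
by rewrite mulr0 addr0.
Qed.

HB.instance Definition _ :=
  GRing.isSubmodClosed.Build R R^nat null_seq null_seq_submod_closed.

Record c0space := C0Seq {
  c0_seq : R^nat ;
  c0_seqP : c0_seq \in null_seq }.

HB.instance Definition _ := [isSub for c0_seq].
HB.instance Definition _ := [Choice of c0space by <:].
HB.instance Definition _ := [SubChoice_isSubLmodule of c0space by <:].

Definition c0norm (u : c0space) : R := supnorm (c0_seq u).

Lemma c0_bdd (u : c0space) : bddfun (c0_seq u).
Proof.
have /asboolP u0 := c0_seqP u.
have : bounded_fun (c0_seq u).
  by apply: cvg_seq_bounded; apply/cvg_ex; exists 0.
move=> [M [_ uM]]; apply/bddfunP; exists (`|M| + 1) => n.
by apply: uM => //; rewrite (le_lt_trans (ler_norm _))// ltrDl.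
Qed.

Lemma c0normD (u v : c0space) : c0norm (u + v) <= c0norm u + c0norm v.
Proof. exact: supnormD (c0_bdd u) (c0_bdd v). Qed.
Lemma c0normZ a (u : c0space) : c0norm (a *: u) = `|a| * c0norm u.
Proof. exact: supnormZ (c0_bdd u). Qed.
Lemma c0norm_eq0 (u : c0space) : c0norm u = 0 -> u = 0.
Proof.
by move=> u0; apply/val_inj/funext => n; exact: (supnorm0_eq0 (c0_bdd u)).
Qed.

HB.instance Definition _ :=
  Lmodule_isNormed.Build R c0space c0normD c0normZ c0norm_eq0.

End c0space.

Record closedSubspace (R : realType) (X : normedModType R) := ClosedSubspace {
  subspace_pred :> submodClosed X ;
  subspace_closed : closed [set x : X | x \in subspace_pred] }.

Definition subspace_of (R : realType) (X : normedModType R)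
  (Y : submodClosed X) : Type := {x : X | x \in Y}.

Section subspace_of.
Context (R : realType) (X : normedModType R) (Y : submodClosed X).
Local Notation sY := (subspace_of Y).

HB.instance Definition _ := SubChoice.on sY.
HB.instance Definition _ := [SubChoice_isSubLmodule of sY by <:].

Definition subspace_norm (y : sY) : R := `|val y|.

Lemma subspace_normD (x y : sY) :
  subspace_norm (x + y) <= subspace_norm x + subspace_norm y.
Proof. exact: ler_normD. Qed.
Lemma subspace_normZ a (x : sY) : subspace_norm (a *: x) = `|a| * subspace_norm x.
Proof. exact: normrZ. Qed.
Lemma subspace_norm_eq0 (x : sY) : subspace_norm x = 0 -> x = 0.
Proof. by move=> /normr0_eq0 x0; exact: val_inj. Qed.

HB.instance Definition _ :=
  Lmodule_isNormed.Build R sY subspace_normD subspace_normZ subspace_norm_eq0.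

End subspace_of.

(* Meaningful for bounded T only: sup is 0 on sets without an upper bound. *)
Definition opnorm (R : realType) (X Y : normedModType R) (T : X -> Y) : R :=
  sup [set `|T x| | x in [set x : X | `|x| <= 1]].

Definition c0_extension_property (R : realType) (X : completeNormedModType R)
    (Y : closedSubspace X) (lambda : R) :=
  forall T : {linear subspace_of Y -> c0space R}, bounded_fun_norm T ->
  exists T' : {linear X -> c0space R},
    [/\ bounded_fun_norm T',
        forall y : subspace_of Y, T' (val y) = T y
      & opnorm T' <= lambda * opnorm T].

Section pullback.
Context (R : realType) (K L : topologicalType).
Context (cK : compact [set: K]) (cL : compact [set: L]).
Context (phi : K -> L) (phi_cont : continuous phi).

Definition pullback (f : Cspace R cL) : Cspace R cK :=
  mkC cK (fun x => continuous_comp (@phi_cont x)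
                               (@Cfun_continuous _ _ _ f (phi x))).

Lemma pullbackE f : Cfun (pullback f) = Cfun f \o phi. Proof. by []. Qed.

Definition pullback_range_pred : {pred Cspace R cK} :=
  [pred f | f \in range pullback].

Lemma pullback_range_submod : submod_closed pullback_range_pred.
Proof.
split; first by rewrite inE; exists 0 => //; exact: CspaceP.
move=> a _ _ /set_mem[f _ <-] /set_mem[g _ <-].
by apply: mem_set; exists (a *: f + g) => //; exact: CspaceP.
Qed.

HB.instance Definition _ := GRing.isSubmodClosed.Build R (Cspace R cK)
  pullback_range_pred pullback_range_submod.

Hypothesis phi_onto : set_surj [set: K] [set: L] phi.

Lemma pullback_range_closed :
  closed [set f : Cspace R cK | f \in pullback_range_pred].
Proof.
move=> f fcl.
have approx e : 0 < e -> exists g : Cspace R cL, `|f - pullback g| <= e.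
  move=> e0; have [_ [/set_mem[g _ <-]]] := fcl _ (nbhsx_ballx f e e0).
  by rewrite -ball_normE => /ltW fg; exists g.
have /choice[s sP] (l : L) : exists x, phi x = l.
  by have [x _ <-] := phi_onto (I : [set: L] l); exists x.
have fs x : Cfun f (s (phi x)) = Cfun f x.
  apply/eqP; rewrite -subr_eq0 -normr_le0; apply/ler_addgt0Pr => e e0.
  have [g fg] := approx (e / 2) (divr_gt0 e0 (ltr0n _ 2)).
  have fgy y : `|Cfun f y - Cfun g (phi y)| <= e / 2.
    exact: le_trans (Cfun_le (f - pullback g) y) fg.
  rewrite add0r [leRHS]splitr.
  rewrite (_ : _ - _ = (Cfun f (s (phi x)) - Cfun g (phi (s (phi x))))
    - (Cfun f x - Cfun g (phi x))); last by rewrite sP; ring.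
  by rewrite (le_trans (ler_normB _ _))// lerD.
have cg : continuous (Cfun f \o s).
  apply: (@uniform_continuous_limit R L cL) => e e0.
  have [g fg] := approx e e0; exists g => l.
  by rewrite -{2}(sP l); exact: le_trans (Cfun_le (f - pullback g) _) fg.
by apply: mem_set; exists (mkC cL cg) => //; exact: CspaceP.
Qed.

(* phi^* C(L); surjectivity makes it closed. *)
Definition pullback_range : closedSubspace (Cspace R cK) :=
  ClosedSubspace pullback_range_closed.

End pullback.

(* Main.v *)
Require Import Defs.
From HB Require Import structures.
From mathcomp Require Import all_boot all_order all_algebra.
From mathcomp Require Import ring lra.
From mathcomp Require Import all_classical all_reals all_analysis.

Set Implicit Arguments.
Unset Strict Implicit.
Unset Printing Implicit Defensive.

Import Order.TTheory GRing.Theory Num.Theory.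
Import numFieldNormedType.Exports.

Local Open Scope classical_set_scope.
Local Open Scope ring_scope.

(** A bounded operator C(L) -> c_0 is a bounded, pointwise null sequence of
    functionals mu_n on C(L). Each mu_n has to be extended along phi^* to C(K)
    in such a way that the extensions are again pointwise null; their norms may
    grow by a factor 2, up to epsilon. Three facts about the spaces are used.

    - Let F be the fibre of phi over p. An interval of K without jumps is
      connected, hence mapped to a point of the zero-dimensional space L; so
      every gap of F contains a jump of K. Cutting each gap at a jump and sending
      the two halves to the two ends of the gap gives a continuous retraction r
      of K onto F that is locally constant off F ([gap_retract]). For f in C(K)
      the function g = f - f \o r vanishes on F.
    - If A is a compact open set containing p, then A \ p is paracompact.
      Hence any countably many compact subsets of A \ p are contained in the
      union of an increasing sequence of compact open sets C_i, and this union
      can be made clopen in A \ p ([paracompact_exhaustion]). As the norms of a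
      functional over disjoint compact open sets add up, it can also be made to
      carry the whole part over A \ p of a given sequence of functionals.
    - A scattered space is exhausted by adding isolated points of complements,
      which gives an induction over L ([extendable_scattered]).

    Let m_n be norm-preserving extensions of mu_n to C(K)
    ([functional_extension]), and suppose that the problem is solved over the
    sets C_(i+1) \ C_i, by functionals nu^i_n. Over A it is solved by
      nu_n f = sum_(i < k_n) nu^i_n g + m_n (1_(A \ C_(k_n)) g) + m_n (1_A) f(a0)
    where a0 is a point of F ([extendable_step]). For f = h \o phi one has
    g = f - h(p), so the value is the prescribed one. The sequence is null
    because g is uniformly small off some C_i, up to a set that no m_n charges,
    while finitely many nu^i act over C_i. As to norms, replacing f by g doubles
    the contribution of the tail A \ C_(k_n), where m_n has not been modified
    before, but it costs almost nothing in the sum: as r is locally constant over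
    C_(i+1) \ C_i, the norms of f |-> nu^i_n (f \o r) tend to 0 for each i
    ([locally_constant_decay]), and k_n is chosen to grow slowly enough. The
    factor 2 is therefore not compounded in the induction. *)

(** * Compactness and zero-dimensional spaces *)

(** An ideal of sets that contains a neighbourhood of each point of a compact
    set contains the set: otherwise the sets whose complement in Q is in P form
    a proper filter on Q without cluster point. *)
Lemma compact_ideal (T : topologicalType) (Q : set T) (P : set T -> Prop) :
  compact Q -> P set0 -> (forall A B, P A -> P B -> P (A `|` B)) ->
  (forall A B, A `<=` B -> P B -> P A) ->
  (forall x, Q x -> exists2 U, nbhs x U & P U) -> P Q.
Proof.
move=> cQ P0 PU PS Ploc; apply: contrapT => nPQ.
pose F : set_system T := [set A | P (Q `\` A)].
have FF : ProperFilter F.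
  split; first by rewrite /F /= setD0.
  split.
  - by rewrite /F /= setDT.
  - by move=> A B FA FB; rewrite /F /= setDIr; exact: PU.
  - by move=> A B AB; apply: PS => x [Qx nBx]; split => // /AB.
have [|x [Qx clx]] := cQ F FF; first by rewrite /F /= setDv.
have [U nU pU] := Ploc x Qx.
have /clx/(_ nU)[y []] // : F (~` U).
by rewrite /F /= setDE setCK; apply: PS pU => y [].
Qed.

(** The quasi-component of a point has an isolated point [y]; separating [y]
    from the rest of it by disjoint open sets, which compactness refines to a
    clopen splitting, shows that [y] is all of it. *)
Lemma scattered_zero_dimensional (T : topologicalType) :
  compact [set: T] -> hausdorff_space T -> scattered T -> zero_dimensional T.
Proof.
move=> cT hT sT x z xz.
pose Q := \bigcap_(D in [set D : set T | clopen D /\ D x]) D.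
have [Qz|] := pselect (Q z); last first.
  by move=> /existsNP[D /not_implyP[[cD Dx] nDz]]; exists D.
have Qx : Q x by move=> D [].
have cQ : closed Q by apply: closed_bigI => D [[]].
have Qsub O : open O -> Q `<=` O -> exists D, [/\ clopen D, D x & D `<=` O].
  move=> oO QO.
  have cO : compact (~` O).
    by apply: (subclosed_compact _ cT) => //; exact: open_closedC.
  pose P (A : set T) := exists D, [/\ clopen D, D x & D `&` A = set0].
  suff [D [cD Dx DO]] : P (~` O).
    by exists D; split => //; exact/subsets_disjoint.
  apply: compact_ideal cO _ _ _ _.
  - by exists setT; split; rewrite ?setI0//; exact: clopenT.
  - move=> A B [D [cD Dx DA]] [E [cE Ex EB]]; exists (D `&` E).
    split => //; first exact: clopenI.
    by rewrite setIUr -setIA (setIC E) setIA DA set0I set0U -setIA EB setI0.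
  - move=> A B AB [D [cD Dx DB]]; exists D; split => //.
    by rewrite -subset0 -DB; exact: setIS.
  - move=> y nOy; have /existsNP[D /not_implyP[[cD Dx] nDy]] : ~ Q y by move/QO.
    exists (~` D); last by exists D; rewrite setICr.
    by apply: open_nbhs_nbhs; split=> //; case: (clopenC set0 cD).
have [y [/set_mem Qy [V nV VQ]]] : isolated Q !=set0 by apply: sT; exists x.
have cQy : closed (Q `\ y).
  have -> : Q `\ y = Q `&` ~` V°.
    apply/seteqP; split => w [Qw].
      move=> wy; split => // /interior_subset Vw.
      by have : (V `&` Q) w by []; rewrite VQ.
    by move=> nVw; split => // wy; apply: nVw; rewrite wy.
  by apply: closedI => //; apply: open_closedC; exact: open_interior.
have hV := @compact_regular T y setT hT cT filterT.
have [W nW clW] : exists2 W, nbhs y W & closure W `<=` ~` (Q `\ y).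
  have : nbhs y (~` (Q `\ y)).
    apply: open_nbhs_nbhs; split; first exact: closed_openC.
    by move=> [_]; apply.
  by move=> /hV[W nW clW]; exists W.
have [||D [cD Dx DO]] := Qsub (W° `|` ~` closure W).
- by apply: openU; [exact: open_interior|apply: closed_openC; exact: closed_closure].
- move=> w Qw; have [->|wy] := eqVneq w y; first by left.
  by right=> /clW; apply; split => //; apply/eqP.
have cDW : clopen (D `&` W°).
  split; first by apply: openI; [case: cD|exact: open_interior].
  have -> : D `&` W° = D `&` closure W.
    apply/seteqP; split => w [Dw].
      by move/interior_subset/subset_closure.
    by move=> cw; split => //; case: (DO _ Dw).
  by apply: closedI; [case: cD|exact: closed_closure].
have [Wx|nWx] := pselect ((W°) x).
  have QW w : Q w -> w = y.
    move=> Qw; have [//|wy] := eqVneq w y.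
    have /(_ (conj cDW (conj Dx Wx)))[_] := Qw (D `&` W°).
    by move=> /interior_subset/subset_closure/clW[]; split => //; apply/eqP.
  by move: xz; rewrite (QW x Qx) (QW z Qz) eqxx.
have cDW' : clopen (D `&` ~` (D `&` W°)).
  by apply: clopenI => //; exact: clopenC set0 cDW.
have /(_ (conj cDW' _))[] := Qy (D `&` ~` (D `&` W°)).
  by split => // -[].
by move=> Dy []; split.
Qed.

(** * Retraction of a compact line onto a closed set with jumps in its gaps *)

Section gap_retraction.
Context (d : Order.disp_t) (K : orderTopologicalType d) (cK : compact [set: K]).
Local Open Scope order_scope.

Lemma convex_nbhs (x : K) (U : set K) : nbhs x U -> exists W : set K,
  [/\ open W, W x, W `<=` U & forall a b c, W a -> W b -> a <= c <= b -> W c].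
Proof.
rewrite itv_nbhsE => -[[l u] [oi xi iU]]; exists [set` Interval l u].
split => //; first exact: itv_open_ends_open.
move=> a b c /=; rewrite !itv_boundlr => /andP[la _] /andP[_ bu] /andP[ac cb].
by rewrite (le_trans la) ?bnd_simp// (le_trans _ bu) ?bnd_simp.
Qed.

Lemma closed_has_max (G : set K) : closed G -> G !=set0 ->
  exists2 g, G g & forall y, G y -> y <= g.
Proof.
move=> clG [g0 Gg0]; apply: contrapT => nomax.
pose P (A : set K) := exists2 g, G g & forall a, A a -> a < g.
have cG : compact G by apply: (subclosed_compact clG cK).
have [|A B [g Gg gA] [h Gh hB]|A B AB [g Gg gB]|x Gx|g Gg /(_ g Gg)] :=
  @compact_ideal K G P cG.
- by exists g0.
- have [gh|/ltW hg] := leP g h.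
    by exists h => // a [/gA/lt_le_trans->|/hB].
  by exists g => // a [/gA|/hB/lt_le_trans->].
- by exists g => // a /AB /gB.
- have [y Gy xy] : exists2 y, G y & x < y.
    apply: contrapT => nxy; apply: nomax; exists x => // y Gy.
    by rewrite leNgt; apply/negP => xy; apply: nxy; exists y.
  exists `]-oo, y[%classic.
    by apply: open_nbhs_nbhs; split; [exact: lray_open|rewrite set_itvE].
  by exists y => // a; rewrite set_itvE.
- by rewrite ltxx.
Qed.

Lemma closed_has_min (G : set K) : closed G -> G !=set0 ->
  exists2 g, G g & forall y, G y -> g <= y.
Proof.
move=> clG [g0 Gg0]; apply: contrapT => nomin.
pose P (A : set K) := exists2 g, G g & forall a, A a -> g < a.
have cG : compact G by apply: (subclosed_compact clG cK).
have [|A B [g Gg gA] [h Gh hB]|A B AB [g Gg gB]|x Gx|g Gg /(_ g Gg)] :=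
  @compact_ideal K G P cG.
- by exists g0.
- have [gh|/ltW hg] := leP g h.
    by exists g => // a [/gA|/hB/(le_lt_trans gh)].
  by exists h => // a [/gA/(le_lt_trans hg)|/hB].
- by exists g => // a /AB /gB.
- have [y Gy xy] : exists2 y, G y & y < x.
    apply: contrapT => nxy; apply: nomin; exists x => // y Gy.
    by rewrite leNgt; apply/negP => xy; apply: nxy; exists y.
  exists `]y, +oo[%classic.
    by apply: open_nbhs_nbhs; split; [exact: rray_open|rewrite set_itvE].
  by exists y => // a; rewrite set_itvE.
- by rewrite ltxx.
Qed.

Context (F : set K) (clF : closed F) (F0 : F !=set0).
Hypothesis sepF : forall x, ~ F x -> exists E, [/\ clopen E, F `<=` E & ~ E x].

(** A jump of K between a and b, given as the initial segment that it ends. *)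
Definition lower_clopen a b (S : set K) :=
  [/\ clopen S, S a, ~ S b & forall x y, x <= y -> S y -> S x].

(** The greatest point below x of a clopen set that contains F but not x is the
    left end of a jump. *)
Lemma gap_cut a x b : F a -> F b -> ~ F x -> a < x < b ->
  exists S, lower_clopen a b S.
Proof.
move=> Fa Fb nFx /andP[ax xb]; have [E [[oE cE] FE nEx]] := sepF nFx.
have [||c [Ec]] := @closed_has_max (E `&` `]-oo, x]%classic).
- by apply: closedI => //; exact: lray_closed.
- by exists a; split; [exact: FE|rewrite set_itvE /= ltW].
rewrite !set_itvE /= => cx cmax.
have {}cx : c < x by rewrite lt_neqAle cx andbT; apply/eqP => cE'; rewrite cE' in Ec.
have SE : `]-oo, c]%classic = `]-oo, c[%classic `|` (E `&` `]-oo, x[%classic).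
  rewrite !set_itvE; apply/seteqP; split=> y /=.
    by rewrite le_eqVlt => /predU1P[->|]; [right|left].
  by move=> [/ltW//|[Ey yx]]; apply: cmax; split; rewrite /= ?ltW.
exists `]-oo, c]%classic; split.
- split; last exact: lray_closed.
  by rewrite SE; apply: openU; [|apply: openI => //]; exact: lray_open.
- by rewrite set_itvE /=; apply: cmax; split; [exact: FE|rewrite /= ltW].
- by rewrite set_itvE /=; apply/negP; rewrite -ltNge (lt_trans cx).
- by move=> y z yz; rewrite !set_itvE /=; exact: le_trans.
Qed.

Let x0 : K := projT1 (cid F0).
(* lo x and hi x are the neighbours of x in F; if x lies beyond all of F on one
   side, both are the end of F that is nearest to x. *)
Let below x : set K := F `&` [set y | y <= x].
Let above x : set K := F `&` [set y | x <= y].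
Let mx (S : set K) := xget x0 [set g | S g /\ forall y, S y -> y <= g].
Let mn (S : set K) := xget x0 [set g | S g /\ forall y, S y -> g <= y].
Let lo x := if pselect (below x !=set0) then mx (below x) else mn (above x).
Let hi x := if pselect (above x !=set0) then mn (above x) else mx (below x).
Let cut a b := xget setT (lower_clopen a b).

(** Each gap (a, b) of F is split at a jump of K that depends on a and b only,
    and its two halves are sent to a and to b. *)
Definition gap_retract x := if pselect (cut (lo x) (hi x) x) then lo x else hi x.

Let mx_spec x : below x !=set0 ->
  [/\ F (mx (below x)), mx (below x) <= x
    & forall y, F y -> y <= x -> y <= mx (below x)].
Proof.
move=> bx; rewrite /mx; case: xgetP => [g _ [[Fg gx] gmax]|no].
  by split => // y Fy yx; exact: gmax.
have [|g Bg gmax] := @closed_has_max (below x) _ bx.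
  apply: closedI => //; have := @lray_closed _ K x.
  by rewrite set_itvE.
by exfalso; apply: (no g).
Qed.

Let mn_spec x : above x !=set0 ->
  [/\ F (mn (above x)), x <= mn (above x)
    & forall y, F y -> x <= y -> mn (above x) <= y].
Proof.
move=> ax; rewrite /mn; case: xgetP => [g _ [[Fg gx] gmax]|no].
  by split => // y Fy yx; exact: gmax.
have [|g Bg gmax] := @closed_has_min (above x) _ ax.
  apply: closedI => //; have := @rray_closed _ K x.
  by rewrite set_itvE.
by exfalso; apply: (no g).
Qed.

Let loE x : below x !=set0 -> lo x = mx (below x).
Proof. by rewrite /lo; case: pselect. Qed.

Let hiE x : above x !=set0 -> hi x = mn (above x).
Proof. by rewrite /hi; case: pselect. Qed.

Let lo_spec x : below x !=set0 ->
  [/\ F (lo x), lo x <= x & forall y, F y -> y <= x -> y <= lo x].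
Proof. by move=> bx; rewrite loE//; exact: mx_spec. Qed.

Let hi_spec x : above x !=set0 ->
  [/\ F (hi x), x <= hi x & forall y, F y -> x <= y -> hi x <= y].
Proof. by move=> ax; rewrite hiE//; exact: mn_spec. Qed.

Let belowVabove x : below x !=set0 \/ above x !=set0.
Proof.
have [y Fy] := F0; have /orP[yx|xy] := le_total y x; [left|right]; by exists y.
Qed.

Let lohi x : lo x <> hi x -> below x !=set0 /\ above x !=set0.
Proof.
rewrite /lo /hi; case: pselect => bx; case: pselect => ax //.
by have [] := belowVabove x.
Qed.

Let F_lohi x : F (lo x) /\ F (hi x).
Proof.
have [E|/eqP/lohi[bx ax]] := eqVneq (lo x) (hi x); last first.
  by split; [case: (lo_spec bx)|case: (hi_spec ax)].
have [bx|ax] := belowVabove x.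
  by rewrite -E; split; case: (lo_spec bx).
by rewrite E; split; case: (hi_spec ax).
Qed.

Let retract_or x : gap_retract x = lo x \/ gap_retract x = hi x.
Proof. by rewrite /gap_retract; case: pselect; [left|right]. Qed.

Lemma gap_retract_in x : F (gap_retract x).
Proof. by case: (retract_or x) => ->; case: (F_lohi x). Qed.

Lemma gap_retract_id x : F x -> gap_retract x = x.
Proof.
move=> Fx; have bx : below x !=set0 by exists x; split => /=.
have ax : above x !=set0 by exists x; split => /=.
have [_ l1 /(_ x Fx (lexx _)) l2] := lo_spec bx.
have [_ h1 /(_ x Fx (lexx _)) h2] := hi_spec ax.
by case: (retract_or x) => ->; apply/le_anti; rewrite ?l1 ?l2 ?h1 ?h2.
Qed.

Lemma gap_retract_locally_constant x : ~ F x ->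
  \forall y \near x, gap_retract y = gap_retract x.
Proof.
move=> nFx.
have [|W [oW Wx WF Wconv]] := @convex_nbhs x (~` F).
  by apply: open_nbhs_nbhs; split => //; exact: closed_openC.
have bW z : W z -> below z = below x.
  move=> Wz; apply/seteqP; split => y [Fy /= yz]; split => //=;
    rewrite leNgt; apply/negP => lt; apply: (WF y) => //.
    by apply: (Wconv x z); rewrite ?(ltW lt).
  by apply: (Wconv z x); rewrite ?(ltW lt).
have aW z : W z -> above z = above x.
  move=> Wz; apply/seteqP; split => y [Fy /= yz]; split => //=;
    rewrite leNgt; apply/negP => lt; apply: (WF y) => //.
    by apply: (Wconv z x); rewrite ?(ltW lt) ?yz.
  by apply: (Wconv x z); rewrite ?(ltW lt) ?yz.
have nW : nbhs x W by exact: open_nbhs_nbhs.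
have E z : W z -> gap_retract z =
    if pselect (cut (lo x) (hi x) z) then lo x else hi x.
  by move=> Wz; rewrite /gap_retract /lo /hi bW// aW.
have [lh|/eqP lh] := eqVneq (lo x) (hi x).
  apply: filterS nW => z Wz; rewrite !E// lh.
  by case: pselect; case: pselect.
have [/lo_spec[Fl lx _] /hi_spec[Fh xh _]] := lohi lh.
have neq y : F y -> x != y by move=> Fy; apply: contra_notN nFx => /eqP->.
have [|S0 S0P] := @gap_cut (lo x) x (hi x) Fl Fh nFx.
  by rewrite !lt_neqAle lx xh eq_sym !neq.
have [[oS cS] _ _ _] : lower_clopen (lo x) (hi x) (cut (lo x) (hi x)).
  by rewrite /cut; case: xgetP => [S _ //|/(_ S0)].
have [Sx|nSx] := pselect (cut (lo x) (hi x) x).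
  have nS : nbhs x (cut (lo x) (hi x)) by exact: open_nbhs_nbhs.
  apply: filterS (filterI nW nS) => z [Wz Sz]; rewrite !E//.
  by case: pselect => // ?; case: pselect.
have nS : nbhs x (~` cut (lo x) (hi x)).
  by apply: open_nbhs_nbhs; split => //; exact: closed_openC.
apply: filterS (filterI nW nS) => z [Wz Sz]; rewrite !E//.
by case: pselect => // ?; case: pselect.
Qed.

(* Points of F that accumulate at x from the right confine the images of the
   points near x; otherwise x is the left end of a gap, or has no points to its
   right nearby, and the part of the gap before its cut is sent to x. *)
Let retract_right x W : F x -> open W -> W x ->
  (forall a b c, W a -> W b -> a <= c <= b -> W c) ->
  \forall y \near x, x <= y -> W (gap_retract y).
Proof.
move=> Fx oW Wx Wconv; have nW : nbhs x W by exact: open_nbhs_nbhs.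
have [[v [Fv xv Wv]]|nov] := pselect (exists v, [/\ F v, x < v & W v]).
  have nv : nbhs x `]-oo, v[%classic.
    by apply: open_nbhs_nbhs; split; [exact: lray_open|rewrite set_itvE].
  apply: filterS nv => y; rewrite set_itvE /= => yv xy.
  have [|_ ly lmax] := @lo_spec y; first by exists x.
  have [|_ hy hmin] := @hi_spec y; first by exists v; split => //=; exact: ltW.
  apply: (Wconv x v) => //; case: (retract_or y) => ->.
    by rewrite lmax// (le_trans ly)// ltW.
  by rewrite (le_trans xy)// hmin// ltW.
have Wlt y v : W y -> F v -> x < v -> y < v.
  move=> Wy Fv xv; rewrite ltNge; apply/negP => vy; apply: nov.
  by exists v; split => //; apply: (Wconv x y); rewrite ?(ltW xv).
have loW y : W y -> x <= y -> lo y = x.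
  move=> Wy xy; have [|Fl ly lmax] := @lo_spec y; first by exists x.
  apply/le_anti; rewrite lmax// andbT leNgt; apply/negP => xl.
  by have := Wlt y _ Wy Fl xl; rewrite ltNge ly.
have [[y0 [xy0 Wy0]]|noy] := pselect (exists y, x < y /\ W y); last first.
  apply: filterS nW => y Wy; rewrite le_eqVlt => /predU1P[<-|xy].
    by rewrite gap_retract_id.
  by exfalso; apply: noy; exists y.
have aboveW y : W y -> x < y -> above y = above y0.
  move=> Wy xy; apply/seteqP; split => v [Fv /= yv]; split => //=;
    by apply/ltW/Wlt => //; exact: (lt_le_trans _ yv).
have nFy y : W y -> x < y -> ~ F y.
  by move=> Wy xy Fy; apply: nov; exists y.
have [lh|/eqP lh] := eqVneq (hi y0) x.
  apply: filterS nW => y Wy; rewrite le_eqVlt => /predU1P[<-|xy].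
    by rewrite gap_retract_id.
  case: (retract_or y) => ->; first by rewrite loW// ltW.
  have [E|/eqP/lohi[_ ay]] := eqVneq (lo y) (hi y).
    by rewrite -E loW// ltW.
  suff -> : hi y = hi y0 by rewrite lh.
  have ay0 : above y0 !=set0 by rewrite -(aboveW y).
  by rewrite !hiE// (aboveW y).
have [|_ ay0] := @lohi y0; first by rewrite loW// ?ltW// => /esym.
have [Fh yh hmin] := hi_spec ay0.
have [|S0 S0P] := @gap_cut x y0 (hi y0) Fx Fh (nFy _ Wy0 xy0).
  rewrite xy0 lt_neqAle yh andbT; apply/eqP => E.
  by apply: (nFy y0) => //; rewrite E.
have [[oS cS] Sx _ _] : lower_clopen x (hi y0) (cut x (hi y0)).
  by rewrite /cut; case: xgetP => [S _ //|/(_ S0)].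
have nS : nbhs x (cut x (hi y0)) by exact: open_nbhs_nbhs.
apply: filterS (filterI nW nS) => y [Wy Sy].
rewrite le_eqVlt => /predU1P[<-|xy]; first by rewrite gap_retract_id.
have hE : hi y = hi y0 by rewrite !hiE ?aboveW.
by rewrite /gap_retract hE loW ?ltW//; case: pselect.
Qed.

Let retract_left x W : F x -> open W -> W x ->
  (forall a b c, W a -> W b -> a <= c <= b -> W c) ->
  \forall y \near x, y <= x -> W (gap_retract y).
Proof.
move=> Fx oW Wx Wconv; have nW : nbhs x W by exact: open_nbhs_nbhs.
have [[v [Fv xv Wv]]|nov] := pselect (exists v, [/\ F v, v < x & W v]).
  have nv : nbhs x `]v, +oo[%classic.
    by apply: open_nbhs_nbhs; split; [exact: rray_open|rewrite set_itvE].
  apply: filterS nv => y; rewrite set_itvE /= => yv xy.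
  have [|_ ly lmax] := @lo_spec y; first by exists v; split => //=; exact: ltW.
  have [|_ hy hmin] := @hi_spec y; first by exists x.
  apply: (Wconv v x) => //; case: (retract_or y) => ->.
    by rewrite lmax ?(ltW yv)//= (le_trans ly).
  by rewrite (le_trans (ltW yv))//= hmin.
have Wlt y v : W y -> F v -> v < x -> v < y.
  move=> Wy Fv xv; rewrite ltNge; apply/negP => vy; apply: nov.
  by exists v; split => //; apply: (Wconv y x); rewrite ?(ltW xv) ?vy.
have hiW y : W y -> y <= x -> hi y = x.
  move=> Wy xy; have [|Fl ly lmax] := @hi_spec y; first by exists x.
  apply/le_anti; rewrite lmax//= leNgt; apply/negP => xl.
  by have := Wlt y _ Wy Fl xl; rewrite ltNge ly.
have [[y0 [xy0 Wy0]]|noy] := pselect (exists y, y < x /\ W y); last first.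
  apply: filterS nW => y Wy; rewrite le_eqVlt => /predU1P[->|xy].
    by rewrite gap_retract_id.
  by exfalso; apply: noy; exists y.
have belowW y : W y -> y < x -> below y = below y0.
  move=> Wy xy; apply/seteqP; split => v [Fv /= yv]; split => //=;
    by apply/ltW/Wlt => //; exact: (le_lt_trans yv).
have nFy y : W y -> y < x -> ~ F y.
  by move=> Wy xy Fy; apply: nov; exists y.
have [lh|/eqP lh] := eqVneq (lo y0) x.
  apply: filterS nW => y Wy; rewrite le_eqVlt => /predU1P[->|xy].
    by rewrite gap_retract_id.
  case: (retract_or y) => ->; last by rewrite hiW// ltW.
  have [E|/eqP/lohi[ay _]] := eqVneq (lo y) (hi y).
    by rewrite E hiW// ltW.
  suff -> : lo y = lo y0 by rewrite lh.
  have ay0 : below y0 !=set0 by rewrite -(belowW y).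
  by rewrite !loE// (belowW y).
have [|ay0 _] := @lohi y0; first by rewrite hiW// ?ltW.
have [Fh yh hmin] := lo_spec ay0.
have [|S0 S0P] := @gap_cut (lo y0) y0 x Fh Fx (nFy _ Wy0 xy0).
  rewrite xy0 lt_neqAle yh !andbT; apply/eqP => E.
  by apply: (nFy y0) => //; rewrite -E.
have [[oS cS] _ Sx _] : lower_clopen (lo y0) x (cut (lo y0) x).
  by rewrite /cut; case: xgetP => [S _ //|/(_ S0)].
have nS : nbhs x (~` cut (lo y0) x).
  by apply: open_nbhs_nbhs; split => //; exact: closed_openC.
apply: filterS (filterI nW nS) => y [Wy Sy].
rewrite le_eqVlt => /predU1P[->|xy]; first by rewrite gap_retract_id.
have hE : lo y = lo y0 by rewrite !loE ?belowW.
by rewrite /gap_retract hE hiW ?ltW//; case: pselect.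
Qed.

Lemma gap_retract_continuous : continuous gap_retract.
Proof.
move=> x U nU; have [Fx|nFx] := pselect (F x); last first.
  have := gap_retract_locally_constant nFx; rewrite nbhs_simpl /=.
  by apply: filterS => y /= ->; exact: nbhs_singleton.
rewrite gap_retract_id// in nU; have [W [oW Wx WU Wconv]] := convex_nbhs nU.
have nl := retract_left Fx oW Wx Wconv; have nr := retract_right Fx oW Wx Wconv.
rewrite nbhs_simpl /=; apply: filterS (filterI nl nr) => y [yl yr].
by apply: WU; have /orP[/yl|/yr] := le_total y x.
Qed.

End gap_retraction.

(** * Compact open exhaustions of paracompact open sets *)

Lemma clopen_of_nbhs (T : topologicalType) (x : T) (U : set T) :
  compact [set: T] -> hausdorff_space T -> zero_dimensional T -> nbhs x U ->
  exists D, [/\ clopen D, D x & D `<=` U].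
Proof.
move=> cT hT zT /(zero_dimensional_cvg hT zT cT)[D [Dx cD] DU].
by exists D.
Qed.

Lemma open_subset_nbhs (T : topologicalType) (O : set T) (x : T) :
  open O -> O x -> nbhs x O.
Proof. by move=> oG Ox; exact: open_nbhs_nbhs. Qed.

Lemma clopen_diff (T : topologicalType) (A B : set T) :
  clopen A -> clopen B -> clopen (A `\` B).
Proof. by move=> cA cB; apply: clopenI => //; exact: clopenC set0 cB. Qed.

Section exhaustion.
Context (L : topologicalType).
Hypotheses (cL : compact [set: L]) (hL : hausdorff_space L).
Hypothesis zL : zero_dimensional L.

Lemma compact_clopen_between (Q X : set L) : compact Q -> open X -> Q `<=` X ->
  exists C, [/\ clopen C, Q `<=` C & C `<=` X].
Proof.
move=> cQ oX QX; pose P (S : set L) := exists C, [/\ clopen C, S `<=` C & C `<=` X].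
apply: (@compact_ideal _ Q P cQ).
- by exists set0; split => //; exact: clopen0.
- move=> A B [C [cC AC CX]] [D [cD BD DX]]; exists (C `|` D); split.
  + exact: clopenU.
  + exact: setUSS.
  + by rewrite subUset.
- by move=> A B AB [C [cC BC CX]]; exists C; split => //; exact: subset_trans BC.
- move=> x /QX Xx; have [|D [cD Dx DX]] := @clopen_of_nbhs _ x X cL hL zL.
    exact: open_subset_nbhs.
  exists D; first by apply: open_subset_nbhs => //; case: cD.
  by exists D; split.
Qed.

Context (X : set L) (oX : open X) (pX : paracompact (set_type X)).

Let img_open (B : set X) : open B -> open (set_val @` B).
Proof.
move=> [G oG <-]; suff -> : set_val @` (set_val @^-1` G : set X) = G `&` X.
  exact: openI.
apply/seteqP; split => [_ [z Gz <-]|x [Gx Xx]]; first by split => //; exact: set_valP.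
by exists (exist _ x (mem_set Xx)).
Qed.

(** In a locally finite refinement of the cover of X by compact open sets, only
    finitely many members meet a given compact set. So C_(i+1) can be chosen to
    contain all the members that meet C_i, and then a member that meets the
    union is contained in it: the union is closed in X. *)
Lemma paracompact_exhaustion (Q : nat -> set L) :
  (forall i, compact (Q i)) -> (forall i, Q i `<=` X) ->
  exists C : nat -> set L,
    [/\ C 0%N = set0, forall i, clopen (C i) /\ C i `<=` X,
        forall i, C i `<=` C i.+1, forall i, Q i `<=` C i.+1
      & open (X `\` \bigcup_i C i)].
Proof.
move=> cQ QX.
pose U : set (set X) := [set set_val @^-1` D | D in [set D : set L | clopen D /\ D `<=` X]].
have [||V [oV covV refV lfV]] := pX (U := U).
- by move=> _ [D [[oD _] _] <-]; exists D.
- apply/seteqP; split => // z _.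
  have [|D [cD Dz DX]] := @clopen_of_nbhs _ (set_val z) X cL hL zL.
    by apply: open_subset_nbhs => //; exact: set_valP.
  by exists (set_val @^-1` D) => //; exists D.
have clV (B : set X) : exists D, V B -> [/\ clopen D, D `<=` X & set_val @` B `<=` D].
  have [VB|?] := pselect (V B); last by exists set0.
  have [_ [D [cD DX] <-] BD] := refV B VB; exists D => _; split => //.
  by move=> _ [z /BD Dz <-].
have /choice[DV DVP] := clV.
pose star (S C' : set L) := forall B : set X, V B ->
  set_val @` B `&` S !=set0 -> set_val @` B `<=` C'.
have starP C : clopen C -> C `<=` X -> exists C', [/\ clopen C', C' `<=` X & star C C'].
  move=> cC CX; pose P (S : set L) := exists C', [/\ clopen C', C' `<=` X & star S C'].
  apply: (@compact_ideal _ C P).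
  - by apply: (subclosed_compact _ cL) => //; case: cC.
  - by exists set0; split => //; [exact: clopen0|move=> B _ [x []]].
  - move=> S S' [C1 [cC1 C1X s1]] [C2 [cC2 C2X s2]]; exists (C1 `|` C2); split.
    + exact: clopenU.
    + by rewrite subUset.
    + move=> B VB [x [Bx [Sx|Sx]]].
        by apply: subset_trans (s1 B VB _) _ => //; exists x.
      by apply: subset_trans (s2 B VB _) _ => //; exists x.
  - move=> S S' SS' [C1 [cC1 C1X s1]]; exists C1; split => //.
    by move=> B VB [x [Bx Sx]]; apply: s1 => //; exists x; split => //; exact: SS'.
  - move=> x /CX Xx; pose z : X := exist _ x (mem_set Xx).
    have [W [_ [[G oG <-] /= Gz GW] finV]] := lfV z.
    exists (G `&` X); first by apply: open_subset_nbhs => //; exact: openI.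
    exists (\bigcup_(B in [set B | V B /\ B `&` W !=set0]) DV B); split.
    + split; first by apply: bigcup_open => B [/DVP[[]]].
      by apply: closed_bigcup => // B [/DVP[[]]].
    + by apply: bigcup_sub => B [/DVP[]].
    + move=> B VB [_ [[w Bw <-] [Gw _]]] y By; exists B.
        by split => //; exists w; split => //; exact: GW.
      by have [_ _] := DVP B VB; apply.
have next i C : exists C', clopen C /\ C `<=` X ->
    [/\ clopen C', C' `<=` X, C `<=` C', Q i `<=` C' & star C C'].
  have [[cC CX]|?] := pselect (clopen C /\ C `<=` X); last by exists set0.
  have [C1 [cC1 C1X s1]] := starP C cC CX.
  have [C2 [cC2 QC2 C2X]] := compact_clopen_between (cQ i) oX (QX i).
  exists (C `|` C1 `|` C2) => _; split.
  - by do 2?apply: clopenU.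
  - by rewrite !subUset.
  - by move=> x; left; left.
  - by move=> x /QC2; right.
  - by move=> B VB BC x Bx; left; right; exact: s1 Bx.
have /choice[f fP] : forall p : nat * set L, exists C', clopen p.2 /\ p.2 `<=` X ->
    [/\ clopen C', C' `<=` X, p.2 `<=` C', Q p.1 `<=` C' & star p.2 C'].
  by move=> [i C]; exact: next.
pose C := fix C i := if i is j.+1 then f (j, C j) else set0.
have CP i : clopen (C i) /\ C i `<=` X.
  elim: i => [|i IH]; first by split => //; exact: clopen0.
  by have [] := fP (i, C i) IH.
exists C; split => //.
- by move=> i; have [] := fP (i, C i) (CP i).
- by move=> i; have [] := fP (i, C i) (CP i).
rewrite openE => x [Xx nCx]; have : [set: X] (exist _ x (mem_set Xx)) by [].
rewrite -covV => -[B VB Bx].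
apply: filterS (open_subset_nbhs (img_open (oV _ VB)) _); last first.
  by exists (exist _ x (mem_set Xx)).
move=> y By; split; first by case: By => z _ <-; exact: set_valP.
move=> [i _ Ciy]; apply: nCx; exists i.+1 => //.
have [_ _ _ _ /(_ B VB) s] := fP (i, C i) (CP i).
by apply: s; [exists y|exists (exist _ x (mem_set Xx))].
Qed.

End exhaustion.

(** * Functionals on C(K) and their norms over clopen sets *)

Section restriction.
Context (R : realType) (T : topologicalType) (cT : compact [set: T]).
Local Notation CT := (Cspace R cT).

Lemma restr_continuous (E : set T) (f : CT) : clopen E ->
  continuous (fun x => (x \in E)%:R * Cfun f x : R).
Proof.
move=> [oE cE] x; have [Ex|nEx] := pselect (E x).
  apply: (@cvg_trans _ (Cfun f @ x)).
    apply: near_eq_cvg; apply: filterS (open_subset_nbhs oE Ex) => y Ey.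
    by rewrite mem_set// mul1r.
  by rewrite mem_set// mul1r; exact: Cfun_continuous.
apply: (@cvg_trans _ ((cst 0 : T -> R) @ x)).
  apply: near_eq_cvg; apply: filterS (open_subset_nbhs (closed_openC cE) nEx) => y Ey.
  by rewrite memNset// mul0r.
by rewrite memNset// mul0r; exact: cvg_cst.
Qed.

(** The product of f and the indicator of E, for clopen E; 0 is a dummy value. *)
Definition restr (E : set T) (f : CT) : CT :=
  if pselect (clopen E) is left cE then mkC cT (@restr_continuous E f cE) else 0.

Lemma restrE E f x : clopen E -> Cfun (restr E f) x = (x \in E)%:R * Cfun f x.
Proof. by rewrite /restr; case: pselect. Qed.

Lemma restr_is_linear E a (f g : CT) : clopen E ->
  restr E (a *: f + g) = a *: restr E f + restr E g.
Proof.
move=> cE; apply: CspaceP => x.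
by rewrite restrE// !(CfunD, CfunZ) !restrE//; ring.
Qed.

Lemma restr_comp E1 E2 f : clopen E1 -> clopen E2 ->
  restr E1 (restr E2 f) = restr (E1 `&` E2) f.
Proof.
move=> c1 c2; apply: CspaceP => x; rewrite !restrE//; last exact: clopenI.
by rewrite in_setI mulrA -natrM mulnb.
Qed.

Lemma restrT f : restr setT f = f.
Proof.
apply: CspaceP => x; rewrite restrE; last exact: clopenT.
by rewrite in_setT mul1r.
Qed.

Lemma restrU E1 E2 f : clopen E1 -> clopen E2 -> E1 `&` E2 = set0 ->
  restr (E1 `|` E2) f = restr E1 f + restr E2 f.
Proof.
move=> c1 c2 E120; apply: CspaceP => x.
rewrite CfunD !restrE//; last exact: clopenU.
rewrite in_setU -mulrDl; congr (_ * _).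
have : x \notin E1 `&` E2 by rewrite E120 in_set0.
by rewrite in_setI; case: (x \in E1); case: (x \in E2) => //= _; rewrite ?addr0 ?add0r.
Qed.

End restriction.

Section functionals.
Context (R : realType) (V : lmodType R).

Definition functional (m : V -> R) :=
  forall a u v, m (a *: u + v) = a * m u + m v.

Context (m : V -> R) (lm : functional m).

Lemma functional0 : m 0 = 0.
Proof.
have := lm 1 0 0; rewrite scale1r addr0 mul1r => /eqP.
by rewrite -subr_eq0 opprD addrA subrr sub0r oppr_eq0 => /eqP.
Qed.

Lemma functionalD u v : m (u + v) = m u + m v.
Proof. by rewrite -[u]scale1r lm mul1r scale1r. Qed.

Lemma functionalZ a u : m (a *: u) = a * m u.
Proof. by rewrite -[a *: u]addr0 lm functional0 addr0. Qed.

Lemma functionalN u : m (- u) = - m u.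
Proof. by rewrite -scaleN1r functionalZ mulN1r. Qed.

Lemma functionalB u v : m (u - v) = m u - m v.
Proof. by rewrite functionalD functionalN. Qed.

End functionals.

Section local_norm.
Context (R : realType) (T : topologicalType) (cT : compact [set: T]).
Local Notation CT := (Cspace R cT).

(** The functions of norm at most 1 that vanish off E. *)
Definition ball_on (E : set T) :=
  [set f : CT | forall x, `|Cfun f x| <= (x \in E)%:R].

(** For clopen E and m given by a measure, this is the total variation of the
    measure on E. *)
Definition local_norm (m : CT -> R) (E : set T) : R := sup (m @` ball_on E).

Context (m : CT -> R) (M : R) (M0 : 0 <= M) (lm : functional m).
Hypothesis bm : forall f, `|m f| <= M * `|f|.

Let ball_on0 E : ball_on E 0.
Proof. by move=> x; rewrite (_ : Cfun _ _ = 0)// normr0. Qed.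

Let has_sup_local_norm E : has_sup (m @` ball_on E).
Proof.
split; first by exists (m 0); exists 0.
exists M => _ [f fE <-]; rewrite (le_trans (ler_norm _))// (le_trans (bm f))//.
rewrite -[leRHS]mulr1 ler_wpM2l// CnormE supnorm_le// => x.
by rewrite (le_trans (fE x))// lern1 leq_b1.
Qed.

Lemma local_norm_ge0 E : 0 <= local_norm m E.
Proof.
apply: ub_le_sup; first by case: (has_sup_local_norm E).
by exists 0 => //; exact: functional0.
Qed.

Lemma local_norm_le E : local_norm m E <= M.
Proof.
apply: ge_sup; first by case: (has_sup_local_norm E).
move=> _ [f fE <-]; rewrite (le_trans (ler_norm _))// (le_trans (bm f))//.
rewrite -[leRHS]mulr1 ler_wpM2l// CnormE supnorm_le// => x.
by rewrite (le_trans (fE x))// lern1 leq_b1.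
Qed.

Lemma le_local_norm (E : set T) (f : CT) c : 0 <= c ->
  (forall x, `|Cfun f x| <= (x \in E)%:R * c) -> `|m f| <= local_norm m E * c.
Proof.
rewrite le_eqVlt => /predU1P[<-|c0] fE.
  suff -> : f = 0 by rewrite functional0// normr0 mulr0.
  apply: CspaceP => x; apply/eqP; rewrite -normr_le0.
  by rewrite (le_trans (fE x))// mulr0.
have le g : (forall x, `|Cfun g x| <= (x \in E)%:R * c) -> m g <= local_norm m E * c.
  move=> gE; rewrite -ler_pdivrMr// mulrC -functionalZ//.
  apply: ub_le_sup; first by case: (has_sup_local_norm E).
  exists (c^-1 *: g) => // x; rewrite CfunZ normrM gtr0_norm ?invr_gt0//.
  by rewrite mulrC ler_pdivrMr.
rewrite ler_norml lerNl -functionalN// !le// => x.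
by rewrite CfunN normrN.
Qed.

Lemma local_norm_superadditive (E1 E2 G : set T) : E1 `&` E2 = set0 ->
  E1 `|` E2 `<=` G -> local_norm m E1 + local_norm m E2 <= local_norm m G.
Proof.
move=> E0 EG; rewrite -lerBrDr; apply: ge_sup.
  by case: (has_sup_local_norm E1).
move=> _ [f fE <-]; rewrite lerBrDr -lerBrDl; apply: ge_sup.
  by case: (has_sup_local_norm E2).
move=> _ [g gE <-]; rewrite lerBrDl -functionalD//.
apply: ub_le_sup; first by case: (has_sup_local_norm G).
exists (f + g) => // x; rewrite CfunD (le_trans (ler_normD _ _))//.
apply: le_trans (lerD (fE x) (gE x)) _; rewrite -natrD ler_nat.
have : x \notin E1 `&` E2 by rewrite E0 in_set0.
rewrite in_setI; have [xG|xG] := boolP (x \in G).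
  by case: (x \in E1); case: (x \in E2).
have : ~ (E1 `|` E2) x by move=> /EG /mem_set; apply/negP.
by move=> /not_orP[n1 n2]; rewrite !memNset.
Qed.

End local_norm.

(** * Null sequences and their decay under a locally constant map *)

Section sequences.
Context (R : realType).

Lemma cvg0_le (u : R^nat) (B : R) : 0 <= B ->
  (forall t, 0 < t -> exists2 w : R^nat, w @ \oo --> (0 : R) &
     \forall n \near \oo, `|u n| <= t * B + w n) ->
  u @ \oo --> (0 : R).
Proof.
move=> B0 H; apply/cvgrPdist_le => s s0.
have B10 : 0 < B + 1 by rewrite ltr_wpDl.
have [|w w0 uw] := H (s / 2 / (B + 1)); first by rewrite !divr_gt0.
have /cvgrPdist_le/(_ (s / 2) (divr_gt0 s0 (ltr0n _ 2))) := w0.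
apply: filterS2 uw => n un; rewrite !sub0r !normrN => wn.
rewrite (le_trans un)// [leRHS]splitr lerD ?(le_trans (ler_norm _) wn)//.
by rewrite mulrAC ler_pdivrMr// ler_wpM2l ?lerDl// divr_ge0 ?ltW.
Qed.

Lemma cvg0_sum (k : nat) (u : nat -> R^nat) :
  (forall i, u i @ \oo --> (0 : R)) ->
  (fun n => \sum_(i < k) u i n) @ \oo --> (0 : R).
Proof.
move=> u0; elim: k => [|k IH].
  by under eq_fun do rewrite big_ord0; exact: cvg_cst.
under eq_fun do rewrite big_ord_recr /=.
by have := cvgD IH (u0 k); rewrite addr0; apply.
Qed.

Lemma cvg0_norm (u : R^nat) : u @ \oo --> (0 : R) -> (fun n => `|u n|) @ \oo --> (0 : R).
Proof. by move=> /cvg_norm; rewrite normr0. Qed.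

(** A diagonal choice: k n is the greatest k <= n with s k n <= t. *)
Lemma slow_index (s : nat -> nat -> R) (t : R) : 0 < t ->
  (forall n, s 0%N n <= t) -> (forall k, s k @ \oo --> (0 : R)) ->
  exists k : nat -> nat, (forall n, s (k n) n <= t) /\
    forall j, \forall n \near \oo, (j <= k n)%N.
Proof.
move=> t0 s0 sk.
have ex n : exists k, (k <= n)%N && (s k n <= t) by exists 0%N; rewrite s0.
have bd n k : (k <= n)%N && (s k n <= t) -> (k <= n)%N by case/andP.
exists (fun n => ex_maxn (ex n) (bd n)); split=> [n|j].
  by case: ex_maxnP => k /andP[].
have /cvgrPdist_le/(_ t t0) sj := sk j.
apply: filterS2 (nbhs_infty_ge j) sj => n jn; rewrite sub0r normrN => sn.
case: ex_maxnP => k _; apply.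
by rewrite jn (le_trans (ler_norm _)).
Qed.

Lemma sum_half_powers (t : R) k : 0 <= t -> \sum_(i < k) t * 2^-1 ^+ i.+1 <= t.
Proof.
move=> t0; suff -> : \sum_(i < k) t * 2^-1 ^+ i.+1 = t * (1 - 2^-1 ^+ k).
  by rewrite -[leRHS]mulr1 ler_wpM2l// gerBl exprn_ge0// invr_ge0.
elim: k => [|k IH]; first by rewrite big_ord0 expr0 subrr mulr0.
by rewrite big_ord_recr /= IH exprS; field.
Qed.

End sequences.

Section decay.
Context (R : realType) (K : topologicalType) (cK : compact [set: K]).
Local Notation CK := (Cspace R cK).

Lemma Cfun_pullback (L : topologicalType) (cL : compact [set: L]) (phi : K -> L)
    (phi_cont : continuous phi) (f : Cspace R cL) x :
  Cfun (pullback cK phi_cont f) x = Cfun f (phi x).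
Proof. by []. Qed.

Definition cst_one : CK := mkC cK (fun x => @cst_continuous K R 1 x).

Lemma cst_oneE x : Cfun cst_one x = 1. Proof. by []. Qed.

(** On a compact open set where r is locally constant, the functions f \o r
    span a finite-dimensional space, on which pointwise convergence of
    functionals is convergence in norm. *)
Lemma locally_constant_decay (r : K -> K) (cr : continuous r) (E : set K)
    (nu : nat -> CK -> R) :
  clopen E -> (forall x, E x -> \forall y \near x, r y = r x) ->
  (forall n, functional (nu n)) -> (forall f, nu^~ f @ \oo --> (0 : R)) ->
  exists b : R^nat, b @ \oo --> (0 : R) /\
    forall n (f : CK) (c : R), 0 <= c -> (forall x, `|Cfun f (r x)| <= c) ->
      `|nu n (restr E (pullback cK cr f))| <= b n * c.
Proof.
move=> cE rE lnu nu0.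
pose dec G := exists b : R^nat, b @ \oo --> (0 : R) /\
    forall n (f : CK) (c : R), 0 <= c -> (forall x, `|Cfun f (r x)| <= c) ->
      `|nu n (restr G (pullback cK cr f))| <= b n * c.
pose P B := exists G, [/\ clopen G, B `<=` G & forall G', clopen G' -> G' `<=` G -> dec G'].
suff [G [cG EG]] : P E by apply.
have coE : compact E by apply: (subclosed_compact _ cK) => //; case: cE.
apply: (compact_ideal coE).
- exists set0; split => //; first exact: clopen0.
  move=> G' cG' G'0; exists (cst 0); split; first exact: cvg_cst.
  move=> n f c c0 fc.
  have -> : restr G' (pullback cK cr f) = 0.
    by apply: CspaceP => x; rewrite restrE// memNset ?mul0r// => /G'0.
  by rewrite functional0// normr0 mul0r.
- move=> A B [G1 [c1 A1 d1]] [G2 [c2 B2 d2]]; exists (G1 `|` G2); split.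
  + exact: clopenU.
  + exact: setUSS.
  + move=> G' cG' G'G.
    have [|b1 [b10 b1P]] := d1 (G' `&` G1) (clopenI cG' c1); first by move=> x [].
    have [|b2 [b20 b2P]] := d2 (G' `\` G1) (clopen_diff cG' c1).
      by move=> x [/G'G[]].
    exists (fun n => b1 n + b2 n); split.
      by have := cvgD b10 b20; rewrite addr0; apply.
    move=> n f c c0 fc.
    have dis : (G' `&` G1) `&` (G' `\` G1) = set0.
      by apply/seteqP; split => // x [[_ ?] []].
    have := @restrU R K cK _ _ (pullback cK cr f) (clopenI cG' c1) (clopen_diff cG' c1) dis.
    rewrite setUIDK => ->; rewrite functionalD//.
    by rewrite (le_trans (ler_normD _ _))// mulrDl lerD ?b1P ?b2P.
- by move=> A B AB [G [cG BG dG]]; exists G; split => //; exact: subset_trans BG.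
- move=> x Ex; pose G := E `&` [set y | r y = r x].
  have [oE clE] := cE.
  have oG : open G.
    rewrite openE => y [Ey ryx]; apply: filterI; first exact: open_subset_nbhs.
    by apply: filterS (rE y Ey) => z /= ->.
  exists G; first exact: open_subset_nbhs.
  exists G; split => //.
    split => //; rewrite -[G]setCK; apply: open_closedC.
    rewrite openE => y /not_andP[nEy|nry].
      apply: filterS (open_subset_nbhs (closed_openC clE) nEy) => z nEz.
      by move=> [].
    have [Ey|nEy] := pselect (E y); last first.
      apply: filterS (open_subset_nbhs (closed_openC clE) nEy) => z nEz.
      by move=> [].
    by apply: filterS (rE y Ey) => z rzy [_ /= rzx]; apply: nry; rewrite /= -rzy.
  move=> G' cG' G'G; exists (fun n => `|nu n (restr G' cst_one)|); split.
    exact: cvg0_norm.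
  move=> n f c c0 fc.
  have -> : restr G' (pullback cK cr f) = Cfun f (r x) *: restr G' cst_one.
    apply: CspaceP => y; rewrite CfunZ !restrE// pullbackE /=.
    have [G'y|?] := pselect (G' y); last by rewrite memNset// !mul0r mulr0.
    by have [_ /= ->] := G'G y G'y; rewrite mem_set// !mul1r mulr1.
  by rewrite functionalZ// normrM mulrC ler_wpM2l.
Qed.

End decay.

(** * Correcting a sequence of functionals over a compact open set *)

Section extendable.
Context (R : realType) (K L : topologicalType).
Context (cK : compact [set: K]) (cL : compact [set: L]).
Context (phi : K -> L) (phi_cont : continuous phi).
Local Notation CK := (Cspace R cK).
Local Notation CL := (Cspace R cL).
Local Notation pb := (@pullback R K L cK cL phi phi_cont).

Definition restr_over (A : set L) (f : CK) : CK := restr (phi @^-1` A) f.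
Definition norm_over (m : CK -> R) (A : set L) := local_norm m (phi @^-1` A).

Lemma clopen_over A : clopen A -> clopen (phi @^-1` A).
Proof. by move=> cA; apply: preimage_clopen. Qed.

Lemma restr_overE A f x : clopen A -> Cfun (restr_over A f) x = (phi x \in A)%:R * Cfun f x.
Proof. by move=> cA; rewrite restrE//; exact: clopen_over. Qed.

Lemma restr_over_linear A a f g : clopen A ->
  restr_over A (a *: f + g) = a *: restr_over A f + restr_over A g.
Proof. by move=> cA; apply: restr_is_linear; exact: clopen_over. Qed.

Lemma restr_over_pullback A h : clopen A -> pb (restr A h) = restr_over A (pb h).
Proof. by move=> cA; apply: CspaceP => x; rewrite restr_overE// !Cfun_pullback restrE. Qed.

Lemma restr_over_comp A B f : clopen A -> clopen B ->
  restr_over A (restr_over B f) = restr_over (A `&` B) f.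
Proof. by move=> cA cB; rewrite /restr_over restr_comp//; exact: clopen_over. Qed.

Lemma restr_overU A B f : clopen A -> clopen B -> A `&` B = set0 ->
  restr_over (A `|` B) f = restr_over A f + restr_over B f.
Proof.
move=> cA cB AB; rewrite /restr_over -restrU//; try exact: clopen_over.
by rewrite -preimage_setI AB preimage_set0.
Qed.

Lemma restr_over_bound (A : set L) (m : CK -> R) (M : R) (f : CK) (c : R) :
  0 <= M -> functional m -> (forall f, `|m f| <= M * `|f|) -> clopen A ->
  0 <= c -> (forall x, A (phi x) -> `|Cfun f x| <= c) ->
  `|m (restr_over A f)| <= norm_over m A * c.
Proof.
move=> M0 lm bm cA c0 fc; apply: (le_local_norm M0 lm bm c0) => x; rewrite restr_overE//.
have [Ax|nAx] := pselect (A (phi x)).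
  by rewrite !mem_set// !mul1r fc.
by rewrite !memNset// !mul0r normr0.
Qed.

(** The functionals m n stand for extensions to C(K) of functionals on C(L)
    that are null over A, but m itself need not be null. It can then be replaced
    by a null sequence that has the same values over A on the functions
    h \o phi, at the cost of a factor 2 in the norm over A. The last clause also
    says that nu n f depends on the values of f over A only. *)
Definition extendable (A : set L) :=
  forall (m : nat -> CK -> R) (M : R), 0 <= M ->
  (forall n, functional (m n)) -> (forall n f, `|m n f| <= M * `|f|) ->
  (forall h, (fun n => m n (restr_over A (pb h))) @ \oo --> (0 : R)) ->
  forall e : R, 0 < e -> exists nu : nat -> CK -> R,
    [/\ forall n, functional (nu n),
        forall n h, nu n (pb h) = m n (restr_over A (pb h)),
        forall f, nu^~ f @ \oo --> (0 : R)
      & forall n f (c : R), 0 <= c -> (forall x, A (phi x) -> `|Cfun f x| <= c) ->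
          `|nu n f| <= (2 * norm_over (m n) A + e) * c].

Lemma extendable0 : extendable set0.
Proof.
move=> m M M0 lm bm m0 e e0; exists (fun _ _ => 0); split.
- by move=> n a u v; rewrite mulr0 addr0.
- move=> n h; have -> : restr_over set0 (pb h) = 0.
    by apply: CspaceP => x; rewrite restr_overE ?in_set0 ?mul0r//; exact: clopen0.
  by rewrite functional0.
- by move=> f; exact: cvg_cst.
- move=> n f c c0 _; rewrite normr0 mulr_ge0//.
  by rewrite addr_ge0 ?(ltW e0)// mulr_ge0//; exact: (local_norm_ge0 M0).
Qed.

Lemma extendableU A B : clopen A -> clopen B -> A `&` B = set0 ->
  extendable A -> extendable B -> extendable (A `|` B).
Proof.
move=> cA cB AB eA eB m M M0 lm bm m0 e e0.
have e20 : 0 < e / 2 by rewrite divr_gt0.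
have cAB := clopenU cA cB.
have [h|nu1 [l1 x1 c1 b1]] := eA m M M0 lm bm _ _ e20.
  have := m0 (restr A h); rewrite restr_over_pullback// restr_over_comp//.
  by rewrite setIidr//; exact: subsetUl.
have [h|nu2 [l2 x2 c2 b2]] := eB m M M0 lm bm _ _ e20.
  have := m0 (restr B h); rewrite restr_over_pullback// restr_over_comp//.
  by rewrite setIidr//; exact: subsetUr.
exists (fun n f => nu1 n f + nu2 n f); split.
- by move=> n a u v; rewrite l1 l2; ring.
- by move=> n h; rewrite x1 x2 restr_overU// functionalD.
- by move=> f; have := cvgD (c1 f) (c2 f); rewrite addr0; apply.
- move=> n f c c0 fc; rewrite (le_trans (ler_normD _ _))//.
  have := b1 n f c c0; have := b2 n f c c0.
  move=> /(_ (fun x Bx => fc x (or_intror Bx))) H2.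
  move=> /(_ (fun x Ax => fc x (or_introl Ax))) H1.
  apply: le_trans (lerD H1 H2) _; rewrite -mulrDl ler_wpM2r//.
  have : norm_over (m n) A + norm_over (m n) B <= norm_over (m n) (A `|` B).
    apply: (local_norm_superadditive M0 (lm n) (bm n)) => //.
    by rewrite -preimage_setI AB preimage_set0.
  by lra.
Qed.

Section step.
Context (A : set L) (p : L) (cA : clopen A) (Ap : A p).
Context (r : K -> K) (cr : continuous r).
Hypotheses (rp : forall x, phi (r x) = p) (rid : forall x, phi x = p -> r x = x).
Hypothesis rloc : forall x, phi x <> p -> \forall y \near x, r y = r x.
Context (C : nat -> set L).
Hypotheses (C0 : C 0%N = set0) (cC : forall i, clopen (C i)).
Hypotheses (CX : forall i, C i `<=` A `\ p) (Cinc : forall i, C i `<=` C i.+1).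
Let W := (A `\ p) `\` \bigcup_i C i.
Hypothesis oW : open W.
Hypotheses (hL : hausdorff_space L) (zL : zero_dimensional L).
Let D i := C i.+1 `\` C i.
Hypothesis extD : forall i, extendable (D i).
Context (m : nat -> CK -> R) (M : R) (M0 : 0 <= M).
Hypotheses (lm : forall n, functional (m n)) (bm : forall n f, `|m n f| <= M * `|f|).
Hypothesis m0 : forall h, (fun n => m n (restr_over A (pb h))) @ \oo --> (0 : R).
Hypothesis mW : forall n E f, clopen E -> E `<=` W -> m n (restr_over E f) = 0.
Context (a0 : K) (a0p : phi a0 = p).

Let cD i : clopen (D i). Proof. exact: clopen_diff. Qed.
Let cAC i : clopen (A `\` C i). Proof. exact: clopen_diff. Qed.

Let sum_over (mu : CK -> R) k f : functional mu ->
  \sum_(i < k) mu (restr_over (D i) f) = mu (restr_over (C k) f).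
Proof.
move=> lmu; elim: k => [|k IH].
  rewrite big_ord0 C0; have -> : restr_over set0 f = 0.
    by apply: CspaceP => x; rewrite restr_overE ?in_set0 ?mul0r//; exact: clopen0.
  by rewrite functional0.
rewrite big_ord_recr /= IH -functionalD// -restr_overU//.
  by rewrite /D setDUK//; exact: Cinc.
by apply/seteqP; split => // x [? []].
Qed.

Let sum_norm_over n k :
  \sum_(i < k) norm_over (m n) (D i) <= norm_over (m n) (C k).
Proof.
elim: k => [|k IH]; first by rewrite big_ord0; exact: (local_norm_ge0 M0).
rewrite big_ord_recr /=; apply: le_trans (lerD IH (lexx _)) _.
apply: (local_norm_superadditive M0) => //.
  by apply/seteqP; split => // x [? []].
by move=> x [/Cinc|[]].
Qed.

Let norm_over_split n k : norm_over (m n) (C k) +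
  norm_over (m n) (A `\` C k) <= norm_over (m n) A.
Proof.
apply: (local_norm_superadditive M0) => //.
  by apply/seteqP; split => // x [? []].
by move=> x [/CX[]|[]].
Qed.

Let g (f : CK) : CK := f - pullback cK cr f.

Let g_linear a u v : g (a *: u + v) = a *: g u + g v.
Proof.
by apply: CspaceP => x; rewrite /g !(CfunB, CfunD, CfunZ, Cfun_pullback); ring.
Qed.

Let g_norm f c : (forall x, A (phi x) -> `|Cfun f x| <= c) ->
  forall x, A (phi x) -> `|Cfun (g f) x| <= 2 * c.
Proof.
move=> fc x Ax; rewrite /g CfunB (le_trans (ler_normB _ _))// mulr_natl mulr2n.
by rewrite lerD ?fc// rp.
Qed.

Let g_pb h : g (pb h) = pb (h - Cfun h p *: cst_one R cL).
Proof.
apply: CspaceP => x; rewrite /g CfunB !Cfun_pullback CfunB CfunZ rp.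
by rewrite cst_oneE mulr1.
Qed.

(* The function f - f \o r vanishes over p, so the points over A where it is
   large have a compact image in A \ p, which is covered by some C_i and a
   compact open subset of W. *)
Let g_small (f : CK) (t : R) : 0 < t -> exists i0 E, [/\ clopen E, E `<=` W &
  forall x, A (phi x) -> ~ C i0 (phi x) -> ~ E (phi x) -> `|Cfun (g f) x| <= t].
Proof.
move=> t0; have cnt i j : (i <= j)%N -> C i `<=` C j.
  elim: j => [|j IH]; first by rewrite leqn0 => /eqP->.
  by rewrite leq_eqVlt => /predU1P[->//|/IH/subset_trans]; apply; exact: Cinc.
pose G := (phi @^-1` A) `&` [set x | t <= `|Cfun (g f) x|].
have cG : compact G.
  apply: (subclosed_compact _ cK) => //; apply: closedI.
    by case: (clopen_over cA).
  apply: (@preimage_closed _ _ (fun x => `|Cfun (g f) x|) [set y | t <= y]).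
    by move=> x _; apply: cvg_norm; exact: Cfun_continuous.
  exact: closed_ge.
pose P (B : set K) := exists i0 E, [/\ clopen E, E `<=` W &
  forall x, B x -> ~ C i0 (phi x) -> E (phi x)].
suff [i0 [E [cE EW GE]]] : P G.
  exists i0, E; split => // x Ax nC nE; rewrite leNgt; apply/negP => /ltW gx.
  by apply/nE/GE.
apply: (compact_ideal cG).
- by exists 0%N, set0; split => //; exact: clopen0.
- move=> B1 B2 [i [E [cE EW BE]]] [j [F [cF FW BF]]].
  exists (maxn i j), (E `|` F); split; first exact: clopenU.
    by rewrite subUset.
  move=> x [Bx|Bx] nC; [left; apply: BE|right; apply: BF] => // /cnt H;
    by apply: nC; apply: H; rewrite ?leq_maxl ?leq_maxr.
- by move=> B1 B2 BB [i [E [cE EW BE]]]; exists i, E; split => // x /BB; exact: BE.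
- move=> x [Ax gx]; have Xx : (A `\ p) (phi x).
    split => // px; have : t <= `|Cfun (g f) x| := gx.
    by rewrite /g CfunB Cfun_pullback rid// subrr normr0 leNgt t0.
  have pre (U : set L) : open U -> U (phi x) -> nbhs x (phi @^-1` U).
    by move=> oU Ux; apply: phi_cont; exact: open_subset_nbhs.
  have [[i _ Cix]|nC] := pselect ((\bigcup_i C i) (phi x)).
    exists (phi @^-1` C i); first by apply: pre => //; case: (cC i).
    by exists i, set0; split => //; exact: clopen0.
  have [|E [cE Ex EW]] := @clopen_of_nbhs L (phi x) W cL hL zL.
    exact: open_subset_nbhs.
  exists (phi @^-1` E); first by apply: pre => //; case: cE.
  by exists 0%N, E; split.
Qed.

(** The sequence nu_n of the introduction; at the finitely many n with
    |m_n (1_A)| > e / 4 it is replaced by m_n itself, restricted to A. *)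
Lemma extendable_step (e : R) : 0 < e -> exists nu : nat -> CK -> R,
    [/\ forall n, functional (nu n),
        forall n h, nu n (pb h) = m n (restr_over A (pb h)),
        forall f, nu^~ f @ \oo --> (0 : R)
      & forall n f (c : R), 0 <= c -> (forall x, A (phi x) -> `|Cfun f x| <= c) ->
          `|nu n f| <= (2 * norm_over (m n) A + e) * c].
Proof.
move=> e0; pose e4 := e / 4; have e40 : 0 < e4 by rewrite divr_gt0.
pose ei i : R := e4 * 2^-1 ^+ i.+1.
have ei0 i : 0 < ei i by rewrite mulr_gt0// exprn_gt0// invr_gt0.
have Apart i : D i `&` A = D i.
  by apply/setIidPl => x [/CX[]].
have nuP i : exists nu : nat -> CK -> R,
    [/\ forall n, functional (nu n),
        forall n h, nu n (pb h) = m n (restr_over (D i) (pb h)),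
        forall f, nu^~ f @ \oo --> (0 : R)
      & forall n f (c : R), 0 <= c -> (forall x, D i (phi x) -> `|Cfun f x| <= c) ->
          `|nu n f| <= (2 * norm_over (m n) (D i) + ei i) * c].
  apply: (extD M0 lm bm _ (ei0 i)) => h.
  have := m0 (restr (D i) h); rewrite restr_over_pullback// restr_over_comp//.
  by rewrite setIC Apart.
have {nuP}/choice[nu nuP] := nuP.
have lnu i n : functional (nu i n) by have [] := nuP i.
have nuloc i n f : nu i n (restr_over (D i) f) = nu i n f.
  apply/eqP; rewrite -subr_eq0 -functionalB// -normr_le0.
  have [_ _ _ /(_ n (restr_over (D i) f - f) 0 (lexx _))] := nuP i.
  rewrite mulr0; apply => x Dx.
  by rewrite CfunB restr_overE// mem_set// mul1r subrr normr0.
have bP i : exists b : R^nat, b @ \oo --> (0 : R) /\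
    forall n (f : CK) (c : R), 0 <= c -> (forall x, `|Cfun f (r x)| <= c) ->
      `|nu i n (pullback cK cr f)| <= b n * c.
  have [_ _ nu0 _] := nuP i.
  have [x Dx|b [b0 bP]] := locally_constant_decay cr (clopen_over (cD i)) _ (lnu i) nu0.
    by apply: rloc; case: Dx => /CX[].
  by exists b; split => // n f c c0 fc; rewrite -nuloc; exact: bP.
have {bP}/choice[b bP] := bP.
have [|k|kk [kk1 kk2]] := @slow_index R (fun k n => \sum_(i < k) b i n) e4 e40.
- by move=> n; rewrite big_ord0 ltW.
- by apply: cvg0_sum => i; case: (bP i).
pose N n f := \sum_(i < kk n) nu i n (g f) + m n (restr_over (A `\` C (kk n)) (g f))
  + m n (restr_over A (cst_one R cK)) * Cfun f a0.
pose good n := `|m n (restr_over A (cst_one R cK))| <= e4.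
pose res n f := if good n then N n f else m n (restr_over A f).
have Vge n E : 0 <= norm_over (m n) E by exact: (local_norm_ge0 M0).
have VM n E : norm_over (m n) E <= M by exact: local_norm_le.
(* The bound 2 |m_n| + e: both the tail and the recursive terms contribute a
   factor 2; the summands e_i, the terms f \o r, and the last term contribute
   at most e / 4 each. *)
have Ng n f c1 : 0 <= c1 ->
   (forall x, A (phi x) -> `|Cfun f x| <= c1) -> good n -> `|N n f| <=
   (2 * norm_over (m n) A + e) * c1.
  move=> c10 fc gn.
  have S1 : `|\sum_(i < kk n) nu i n (g f)| <=
     (2 * norm_over (m n) (C (kk n)) + e4) * c1 + e4 * c1.
    have -> : \sum_(i < kk n) nu i n (g f) =
       \sum_(i < kk n) nu i n f - \sum_(i < kk n) nu i n (pullback cK cr f).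
      by rewrite -sumrB; apply: eq_bigr => i _; rewrite functionalB.
    rewrite (le_trans (ler_normB _ _))// lerD//; apply: le_trans (ler_norm_sum _ _ _) _.
      apply: (@le_trans _ _ (\sum_(i < kk n) (2 * norm_over (m n) (D i) + ei i) * c1)).
        apply: ler_sum => i _; have [_ _ _] := nuP i; apply => // x [/CX[Ax _] _].
        exact: fc.
      rewrite -mulr_suml ler_wpM2r// big_split /= -mulr_sumr.
      by apply: lerD; [|exact/sum_half_powers/ltW];
        apply: ler_wpM2l (sum_norm_over _ _).
    apply: (@le_trans _ _ (\sum_(i < kk n) b i n * c1)).
      by apply: ler_sum => i _; have [_] := bP i; apply => // x; apply: fc; rewrite rp.
    by rewrite -mulr_suml ler_wpM2r.
  have S2 : `|m n (restr_over (A `\` C (kk n)) (g f))| <=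
     norm_over (m n) (A `\` C (kk n)) * (2 * c1).
    apply: (restr_over_bound M0) => //; first by rewrite mulr_ge0.
    by move=> x [Ax _]; exact: g_norm.
  have S3 : `|m n (restr_over A (cst_one R cK)) * Cfun f a0| <= e4 * c1.
    by rewrite normrM ler_pM// fc// a0p.
  have := norm_over_split n (kk n).
  set v1 := norm_over _ _; set v2 := norm_over _ _; set v := norm_over _ _ => vv.
  apply: (@le_trans _ _ ((2 * v1 + e4) * c1 + e4 * c1 + v2 * (2 * c1) + e4 * c1)).
    by rewrite (le_trans (ler_normD _ _))// lerD// (le_trans (ler_normD _ _))// lerD.
  rewrite [leLHS](_ : _ = (2 * (v1 + v2) + 3 * e4) * c1); last by ring.
  by rewrite ler_wpM2r// /e4; lra.
exists res; split.
- move=> n a u v; rewrite /res; case: ifP => _; last by rewrite restr_over_linear// lm.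
  rewrite /N g_linear restr_over_linear// lm CfunD CfunZ.
  have -> : \sum_(i < kk n) nu i n (a *: g u + g v) =
     a * (\sum_(i < kk n) nu i n (g u)) + \sum_(i < kk n) nu i n (g v).
    by rewrite mulr_sumr -big_split; apply: eq_bigr => i _; rewrite lnu.
  by ring.
- move=> n h; rewrite /res; case: ifP => // _; rewrite /N g_pb.
  set h' := h - _.
  have -> : \sum_(i < kk n) nu i n (pb h') = m n (restr_over (C (kk n)) (pb h')).
    by rewrite -sum_over//; apply: eq_bigr => i _; have [_ ->] := nuP i.
  rewrite -functionalD// -restr_overU//; last by apply/seteqP; split => // x [? []].
  have -> : C (kk n) `|` A `\` C (kk n) = A.
    by rewrite setDUK// => x /CX[].
  have -> : restr_over A (pb h') =
      restr_over A (pb h) - Cfun h p *: restr_over A (cst_one R cK).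
    apply: CspaceP => x; rewrite CfunB CfunZ !restr_overE//.
    rewrite !Cfun_pullback /h' CfunB CfunZ !cst_oneE.
    by ring.
  by rewrite functionalB// (functionalZ (lm n)) Cfun_pullback a0p; ring.
- move=> f; apply: (@cvg0_le R _ (3 * M + e4)).
    by apply: addr_ge0 (ltW e40); apply: mulr_ge0.
  move=> t t0; have [i0 [E [cE EW gE]]] := g_small f t0.
  have m1 : (fun n => m n (restr_over A (cst_one R cK))) @ \oo --> (0 : R).
    have <- : pb (cst_one R cL) = cst_one R cK by exact: CspaceP.
    exact: m0.
  exists (fun n => \sum_(i < i0) `|nu i n (g f)| +
     `|m n (restr_over A (cst_one R cK))| * `|Cfun f a0|).
    have s0 : (fun n => \sum_(i < i0) `|nu i n (g f)|) @ \oo --> (0 : R).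
      by apply: (@cvg0_sum R i0 (fun i n => `|nu i n (g f)|)) => i;
        apply: cvg0_norm; have [_ _] := nuP i.
    have cst0 : (fun _ : nat => `|Cfun f a0|) @ \oo --> `|Cfun f a0| by exact: cvg_cst.
    have := cvgD s0 (cvgM (cvg0_norm m1) cst0).
    by rewrite mul0r addr0; apply.
  have /cvgrPdist_le/(_ e4 e40) := m1.
  apply: filterS2 (kk2 i0) => n ik; rewrite sub0r normrN => gn.
  rewrite /res /good gn /N.
  have S1 : `|\sum_(i < kk n) nu i n (g f)| <=
     (2 * norm_over (m n) (C (kk n)) + e4) * t + \sum_(i < i0) `|nu i n (g f)|.
    rewrite (big_ord_widen _ (fun i => `|nu i n (g f)|) ik) [X in _ <= _ + X]big_mkcond /=.
    apply: le_trans (ler_norm_sum _ _ _) _.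
    apply: (@le_trans _ _ (\sum_(i < kk n) ((2 * norm_over (m n) (D i) + ei i) * t +
       (if (i < i0)%N then `|nu i n (g f)| else 0)))).
      apply: ler_sum => i _; have V0 : 0 <= (2 * norm_over (m n) (D i) + ei i) * t.
        by rewrite mulr_ge0// ?ltW// ltr_wpDl// mulr_ge0.
      case: ltnP => [_|i0i]; first by rewrite lerDr.
      rewrite addr0; have [_ _ _] := nuP i; apply; first exact: ltW.
      move=> x [Ci nCi]; apply: gE; first by case: (CX Ci).
        move=> Ci0; apply: nCi.
        elim: (nat_of_ord i) i0i => [|j IH]; first by rewrite leqn0 => /eqP <-.
        by rewrite leq_eqVlt => /predU1P[<-//|/IH]; exact: Cinc.
      by move=> /EW[_ []]; exists i.+1.
    rewrite big_split /= lerD// -mulr_suml; apply: ler_wpM2r; first exact: ltW.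
    rewrite big_split /= -mulr_sumr.
    by apply: lerD; [|exact/sum_half_powers/ltW];
        apply: ler_wpM2l (sum_norm_over _ _).
  have S2 : `|m n (restr_over (A `\` C (kk n)) (g f))| <= M * t.
    have -> : m n (restr_over (A `\` C (kk n)) (g f)) =
        m n (restr_over ((A `\` C (kk n)) `\` E) (g f)).
      have cI := clopenI (cAC (kk n)) cE; have cE' := clopen_diff (cAC (kk n)) cE.
      rewrite -[in LHS](setUIDK (A `\` C (kk n)) E) restr_overU//.
        by rewrite functionalD// mW ?add0r// => x [_ /EW].
      by apply/seteqP; split => // x [[_ ?] []].
    apply: (@le_trans _ _ (norm_over (m n) ((A `\` C (kk n)) `\` E) * t)).
      apply: (restr_over_bound M0) => //; [exact: clopen_diff|exact: ltW|].
      move=> x [[Ax nC] nE]; apply: gE => // Ci0; apply: nC.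
      elim: (kk n) ik => [|j IH]; first by rewrite leqn0 => /eqP <-.
      by rewrite leq_eqVlt => /predU1P[<-//|/IH]; exact: Cinc.
    by rewrite ler_wpM2r// ltW.
  apply: (@le_trans _ _ ((2 * norm_over (m n) (C (kk n)) + e4) * t +
      \sum_(i < i0) `|nu i n (g f)| + M * t +
      `|m n (restr_over A (cst_one R cK))| * `|Cfun f a0|)).
    rewrite (le_trans (ler_normD _ _))// lerD ?normrM//.
    by rewrite (le_trans (ler_normD _ _))// lerD.
  have := ler_wpM2l (ltW t0) (VM n (C (kk n))); move: (norm_over _ _) => v vM.
  by lra.
- move=> n f c1 c10 fc; rewrite /res; case: ifP => gn; first exact: Ng.
  apply: le_trans (restr_over_bound M0 (lm n) (bm n) cA c10 fc) _.
  by rewrite ler_wpM2r//; have := Vge n A; lra.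
Qed.

End step.
End extendable.

(** * Induction over a scattered space *)

Section induction.
Context (R : realType) (d : Order.disp_t) (K : orderTopologicalType d).
Context (L : topologicalType) (cK : compact [set: K]) (cL : compact [set: L]) (hL : hausdorff_space L).
Context (phi : K -> L) (phi_cont : continuous phi).
Context (phi_onto : forall l, exists x, phi x = l).
Local Notation CK := (Cspace R cK).
Local Notation CL := (Cspace R cL).
Local Notation ext := (@extendable R K L cK cL phi phi_cont).
Hypothesis pL : hereditarily_paracompact L.

Let closed1 (p : L) : closed [set p].
Proof. exact/accessible_closed_set1/hausdorff_accessible. Qed.

(** The exhaustion C is made to contain, for each n, compact open sets over
    which the norm of m n comes arbitrarily close to its supremum. Then m n
    vanishes over every compact open set disjoint from all C_i, since norms over
    disjoint sets add up. *)
Lemma extendable_punctured (zL : zero_dimensional L) (A : set L) (p : L) :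
  clopen A -> A p ->
  (forall D, clopen D -> D `<=` A `\ p -> ext D) -> ext A.
Proof.
move=> cA Ap extD m M M0 lm bm m0 e e0.
have Vge n E : 0 <= norm_over phi (m n) E by exact: (local_norm_ge0 M0).
have oX : open (A `\ p).
  by apply: openI; [case: cA|exact/closed_openC/closed1].
pose S n := [set norm_over phi (m n) E | E in [set E | clopen E /\ E `<=` A `\ p]].
have supS n : has_sup (S n).
  split.
    exists (norm_over phi (m n) set0); exists set0 => //; split => //.
    exact: clopen0.
  by exists M => _ [E _ <-]; exact: local_norm_le.
have QP (nj : nat * nat) : exists Q, [/\ clopen Q, Q `<=` A `\ p &
    sup (S nj.1) - nj.2.+1%:R^-1 < norm_over phi (m nj.1) Q].
  have [|_ [Q [cQ QX] <-] lt] := @sup_adherent R (S nj.1) nj.2.+1%:R^-1 _ (supS nj.1).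
    by rewrite invr_gt0.
  by exists Q.
have /choice[Q0 Q0P] := QP.
pose Q k := if unpickle k is Some nj then Q0 nj else set0.
have cQ k : clopen (Q k).
  by rewrite /Q; case: unpickle => [nj|]; [case: (Q0P nj)|exact: clopen0].
have [||C [C0 CP Cinc QC oW]] := paracompact_exhaustion cL hL zL oX (@pL _) (Q := Q).
- by move=> k; apply: (subclosed_compact _ cL) => //; case: (cQ k).
- by move=> k; rewrite /Q; case: unpickle => [nj|//]; case: (Q0P nj).
have F0 : phi @^-1` [set p] !=set0 by have [x xp] := phi_onto p; exists x.
have clF : closed (phi @^-1` [set p]).
  by apply: preimage_closed => [x _|]; [exact: phi_cont|exact: closed1].
have sepF x : ~ (phi @^-1` [set p]) x ->
    exists E, [/\ clopen E, phi @^-1` [set p] `<=` E & ~ E x].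
  move=> px; have [|D [cD Dp nD]] := zL p (phi x).
    by apply/eqP => E; apply: px.
  exists (phi @^-1` D); split => //; first exact: preimage_clopen.
  by move=> y /= ->.
have [a0 a0p] := phi_onto p.
have cr : continuous (gap_retract F0) by move=> x; exact: gap_retract_continuous.
apply: (@extendable_step R K L cK cL phi phi_cont A p cA Ap (gap_retract F0) cr
   _ _ _ C C0 _ _ Cinc oW hL zL _ m M M0 lm bm m0 _ a0 a0p e e0).
- exact: (gap_retract_in cK clF F0).
- by move=> x; exact: gap_retract_id.
- by move=> x; exact: gap_retract_locally_constant.
- by move=> i; case: (CP i).
- by move=> i; case: (CP i).
- move=> i; apply: extD; first by apply: clopen_diff; [case: (CP i.+1)|case: (CP i)].
  by have [_ CX] := CP i.+1; move=> x [/CX].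
- move=> n E f cE EW.
  suff V0 : norm_over phi (m n) E <= 0.
    have fle x : E (phi x) -> `|Cfun f x| <= `|f| by move=> _; exact: Cfun_le.
    have := restr_over_bound phi_cont M0 (lm n) (bm n) cE (normr_ge0 f) fle.
    have -> : norm_over phi (m n) E = 0 by apply/le_anti; rewrite V0 Vge.
    by rewrite mul0r normr_le0 => /eqP.
  rewrite leNgt; apply/negP => /ltr_add_invr[j]; rewrite add0r => jE.
  have [cQ0 QX] := Q0P (n, j); rewrite ltrBlDr => lt.
  suff : norm_over phi (m n) (Q0 (n, j)) + norm_over phi (m n) E <= sup (S n).
    by apply/negP; rewrite -ltNge (lt_le_trans lt)// lerD2l ltW.
  apply: (@le_trans _ _ (norm_over phi (m n) (Q0 (n, j) `|` E))).
    apply: (local_norm_superadditive M0) => //.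
    apply/seteqP; split => // x [/= Qx /EW[_ []]].
    exists (pickle (n, j)).+1 => //; apply: QC.
    by rewrite /Q pickleK.
  apply: ub_le_sup; first by case: (supS n).
  exists (Q0 (n, j) `|` E) => //; split; first exact: clopenU.
  by rewrite subUset; split => // x /EW[].
Qed.

Let hered (A : set L) := forall B, clopen B -> B `<=` A -> ext B.

Let hered_compact (B : set L) : compact B ->
  (forall x, B x -> exists A, [/\ clopen A, A x & hered A]) ->
  exists A, [/\ clopen A, B `<=` A & hered A].
Proof.
move=> cB Bloc; pose P (S : set L) := exists A, [/\ clopen A, S `<=` A & hered A].
apply: (@compact_ideal _ B P cB).
- exists set0; split => //; first exact: clopen0.
  by move=> E _ E0; rewrite (_ : E = set0); [exact: extendable0|rewrite -subset0].
- move=> B1 B2 [A1 [c1 B1A h1]] [A2 [c2 B2A h2]]; exists (A1 `|` A2); split.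
  + exact: clopenU.
  + exact: setUSS.
  + move=> E cE EA; rewrite -(setUIDK E A1).
    have cI := clopenI cE c1; have cDf := clopen_diff cE c1.
    apply: extendableU => //.
    * by apply/seteqP; split => // x [[_ ?] []].
    * by apply: h1 => // x [].
    * by apply: h2 => // x [/EA[]].
- by move=> B1 B2 BB [A [cA BA hA]]; exists A; split => //; exact: subset_trans BA.
- move=> x /Bloc[A [cA Ax hA]]; exists A; first by apply: open_subset_nbhs => //; case: cA.
  by exists A; split.
Qed.

(** Let G be the union of the compact open sets all of whose compact open subsets
    are extendable; by compactness every compact open subset of G is extendable.
    An isolated point p of the complement has a compact open neighbourhood A with
    A \ p in G, and then p lies in G as well. *)
Lemma extendable_scattered : scattered L -> ext [set: L].
Proof.
move=> sL; have zL := scattered_zero_dimensional cL hL sL.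
pose G := \bigcup_(A in [set A | clopen A /\ hered A]) A.
have comp (B : set L) : clopen B -> B `<=` G -> ext B.
  move=> cB BG; have coB : compact B.
    by apply: (subclosed_compact _ cL) => //; case: cB.
  have [x /BG[A [cA hA] Ax]|A [cA BA hA]] := hered_compact coB; first by exists A; split.
  exact: hA.
suff GT : G = setT by apply: comp => //; [exact: clopenT|rewrite GT].
apply/seteqP; split => // x _; apply: contrapT => nGx.
have [p [/set_mem nGp [V nV VG]]] : isolated (~` G) !=set0 by apply: sL; exists x.
have [A [cA Ap AV]] := clopen_of_nbhs cL hL zL nV.
have AG y : A y -> y <> p -> G y.
  move=> /AV Vy yp; apply: contrapT => nGy.
  by have : (V `&` ~` G) y by []; rewrite VG.
apply: nGp; exists A => //; split => // B cB BA.
have [Bp|nBp] := pselect (B p); last first.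
  by apply: comp => // y By; apply: AG; [exact: BA|move=> yp; rewrite yp in By].
apply: (extendable_punctured zL cB Bp) => D cD DB; apply: comp => // y /DB[/BA Ay yp].
exact: AG.
Qed.

End induction.

(** * Extension of single functionals and the theorem *)

Section functional_extension.
Context (R : realType) (K L : topologicalType).
Context (cK : compact [set: K]) (cL : compact [set: L]) (hL : hausdorff_space L).
Context (zL : zero_dimensional L).
Context (phi : K -> L) (phi_cont : continuous phi).
Context (phi_onto : forall l, exists x, phi x = l).
Local Notation CK := (Cspace R cK).
Local Notation CL := (Cspace R cL).
Local Notation pb := (@pullback R K L cK cL phi phi_cont).

Lemma ultrafilter_bounded_cvg (I : Type) (G : set_system I) (u : I -> R) (B : R) :
  UltraFilter G -> (forall i, `|u i| <= B) -> exists2 l, `|l| <= B & u @ G --> l.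
Proof.
move=> UG uB; have uGB : (u @ G) `[- B, B]%classic.
  suff : G (u @^-1` `[- B, B]%classic) by [].
  apply: filterS (@filterT _ G _) => i _.
  by rewrite /= in_itv /= -ler_norml.
have [l [lB cl]] := @segment_compact R (- B) B (u @ G) _ uGB.
exists l; first by move: lB; rewrite /= in_itv /= ler_norml.
move=> V nV; have [//|GV] := in_ultra_setVsetC (u @^-1` V) UG.
by have [y []] := cl (~` V) V GV nV.
Qed.

Let agree (s : seq (set L)) (l l' : L) := forall A : set L, A \in s -> A l <-> A l'.
Let clopens (s : seq (set L)) := forall A : set L, A \in s -> clopen A.

Let clopen_oscillation (h : CL) (t : R) : 0 < t ->
  exists2 s, clopens s & forall l l', agree s l l' -> `|Cfun h l - Cfun h l'| <= t.
Proof.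
move=> t0; pose P (B : set L) := exists2 s, clopens s &
  forall l l', B l -> agree s l l' -> `|Cfun h l - Cfun h l'| <= t.
suff [s cs sP] : P setT by exists s => // l l'; exact: sP.
apply: (compact_ideal cL).
- by exists [::].
- move=> A B [s1 c1 s1P] [s2 c2 s2P]; exists (s1 ++ s2).
    by move=> E; rewrite mem_cat => /orP[/c1|/c2].
  move=> l l' [Al|Bl] ag; [apply: s1P|apply: s2P] => // E Es; apply: ag;
    by rewrite mem_cat Es ?orbT.
- by move=> A B AB [s cs sP]; exists s => // l l' /AB; exact: sP.
- move=> l _; have t20 : 0 < t / 2 by rewrite divr_gt0.
  have /cvgrPdist_le/(_ _ t20) hl := @Cfun_continuous _ _ _ h l.
  have [D [cD Dl DP]] := clopen_of_nbhs cL hL zL hl.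
  exists D; first by apply: open_subset_nbhs => //; case: cD.
  exists [:: D]; first by move=> E; rewrite inE => /eqP->.
  move=> k k' Dk ag; have Dk' : D k' by apply/(ag D) => //; rewrite inE.
  rewrite -(subrKA (Cfun h l)) [leRHS]splitr (le_trans (ler_normD _ _))// lerD//.
    by rewrite distrC; exact: DP.
  exact: DP.
Qed.

(* An approximate section sg of phi: phi \o sg may move points of L, but only
   within the pieces of the finite partition generated by s. *)
Let section (s : seq (set L)) :=
  [set sg : L -> K | continuous sg /\ forall l, agree s (phi (sg l)) l].

Let section_exists (s : seq (set L)) (k0 : K) : clopens s -> section s !=set0.
Proof.
move=> cs; pose pat l : seq bool := [seq `[< A l >] | A <- s].
have patP l l' : pat l = pat l' -> agree s l l'.
  move=> /eq_in_map E A /E Al.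
  by split=> /asboolP H; apply/asboolP; rewrite ?Al// -Al.
exists (fun l => xget k0 [set k | pat (phi k) = pat l]); split.
  move=> l; have : \forall l' \near l, pat l' = pat l.
    rewrite /pat; elim: (s) cs => [|A s' IH] cs; first by near=> l'.
    have cA : clopen A by apply: cs; rewrite inE eqxx.
    have nA : \forall l' \near l, `[< A l' >] = `[< A l >].
      have [Al|nAl] := pselect (A l).
        apply: filterS (open_subset_nbhs (proj1 cA) Al) => l' Al'.
        by rewrite !asboolT.
      apply: filterS (open_subset_nbhs (closed_openC (proj2 cA)) nAl) => l' Al'.
      by rewrite !asboolF.
    have /IH : clopens s' by move=> B Bs; apply: cs; rewrite inE Bs orbT.
    by apply: filterS2 nA => l' /= -> ->.
  move=> pl U nU; rewrite nbhs_simpl /=.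
  by apply: filterS pl => l' /= ->; exact: nbhs_singleton.
move=> l; apply: patP; case: xgetP => [k _ //|no].
by have [k kl] := phi_onto l; case: (no k); rewrite /= kl.
Unshelve. all: by end_near. Qed.

(** Composition with a continuous approximate section of phi is an operator
    C(K) -> C(L) of norm at most 1. The extension is a limit of the composites of
    mu with these operators along an ultrafilter. *)
Lemma functional_extension (mu : CL -> R) (M : R) : 0 <= M -> functional mu ->
  (forall h, `|mu h| <= M * `|h|) ->
  exists m : CK -> R, [/\ functional m, forall f, `|m f| <= M * `|f|
    & forall h, m (pb h) = mu h].
Proof.
move=> M0 lmu bmu.
have [[k0 _]|noK] := pselect ([set: K] !=set0); last first.
  exists (fun _ => 0); split.
  - by move=> a u v; rewrite mulr0 addr0.
  - by move=> f; rewrite normr0 mulr_ge0.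
  - move=> h; have -> : h = 0.
      by apply: CspaceP => l; have [k _] := phi_onto l; exfalso; apply: noK; exists k.
    by rewrite functional0.
pose F := filter_from clopens section.
have FF : ProperFilter F.
  apply: filter_from_proper; last by move=> s; exact: section_exists.
  apply: filter_from_filter; first by exists [::].
  move=> s1 s2 c1 c2; exists (s1 ++ s2).
    by move=> E; rewrite mem_cat => /orP[/c1|/c2].
  move=> sg [csg ag]; split; split => // l A As; apply: ag;
    by rewrite mem_cat As ?orbT.
have [G [UG FG]] := ultraFilterLemma FF.
pose E (sg : L -> K) (f : CK) : CL :=
  if pselect (continuous sg) is left c then pullback cL c f else 0.
have ElE sg a f g : E sg (a *: f + g) = a *: E sg f + E sg g.
  rewrite /E; case: pselect => [c|_]; first exact: CspaceP.
  by rewrite scaler0 addr0.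
have EN sg f : `|E sg f| <= `|f|.
  rewrite /E; case: pselect => [c|_]; last by rewrite normr0.
  by rewrite CnormE supnorm_le// => l; exact: (Cfun_le f (sg l)).
have uB f sg : `|mu (E sg f)| <= M * `|f|.
  by rewrite (le_trans (bmu _))// ler_wpM2l.
have ex f := ultrafilter_bounded_cvg UG (uB f).
pose m f := s2val (cid2 (ex f)).
have mB f : `|m f| <= M * `|f| by rewrite /m; case: cid2.
have mG f : (fun sg => mu (E sg f)) @ G --> m f by rewrite /m; case: cid2.
have limU (u : (L -> K) -> R) (a b : R) : u @ G --> a -> u @ G --> b -> a = b.
  move=> ua ub; have PG : ProperFilter (u @ G) by apply: fmap_proper_filter.
  exact: (@cvg_unique _ (@Rhausdorff R) _ PG _ _ ua ub).
exists m; split => //.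
- move=> a u v; apply: limU (mG _) _.
  under eq_fun do rewrite ElE lmu.
  by apply: cvgD (mG v); apply: cvgM (mG u); exact: cvg_cst.
- move=> h; apply: limU (mG _) _; apply/cvgrPdist_le => t t0.
  have M10 : 0 < M + 1 by rewrite ltr_wpDl.
  have [|s cs sP] := @clopen_oscillation h (t / (M + 1)); first by rewrite divr_gt0.
  suff : F [set sg | `|mu h - mu (E sg (pb h))| <= t] by move/FG.
  exists s => // sg [csg ag] /=; rewrite -functionalB// (le_trans (bmu _))//.
  apply: (@le_trans _ _ (M * (t / (M + 1)))).
    rewrite ler_wpM2l// CnormE supnorm_le ?divr_ge0 ?ltW// => l.
    rewrite CfunB /E; case: pselect => // c; rewrite !Cfun_pullback distrC.
    by apply: sP; exact: ag.
  by rewrite mulrCA (ler_piMr (ltW t0))// ler_pdivrMr// mul1r lerDl.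
Qed.

End functional_extension.

Lemma opnorm_bound (R : realType) (X Y : normedModType R) (T : {linear X -> Y}) x :
  bounded_fun_norm T -> `|T x| <= opnorm T * `|x|.
Proof.
move=> /(_ 1)[M TM]; have [->|x0] := eqVneq x 0.
  by rewrite linear0 !normr0 mulr0.
rewrite -ler_pdivrMr ?normr_gt0// -[X in _ * X]ger0_norm ?invr_ge0//.
rewrite mulrC -normrZ -linearZ; apply: ub_le_sup.
  by exists M => _ [y y1 <-]; exact: TM.
exists (`|x|^-1 *: x) => //=.
by rewrite normrZ ger0_norm ?invr_ge0// mulVf ?normr_eq0.
Qed.

Theorem mainTheorem3 (R : realType)
    (d : Order.disp_t) (K : orderTopologicalType d) (cK : compact [set: K])
    (L : topologicalType) (cL : compact [set: L]) (hL : hausdorff_space L)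
    (pL : hereditarily_paracompact L) (sL : scattered L)
    (phi : K -> L) (phi_cont : continuous phi)
    (phi_onto : set_surj [set: K] [set: L] phi)
    (eps : R) (eps_gt0 : 0 < eps) :
  c0_extension_property (pullback_range R cK cL phi_cont phi_onto) (2 + eps).
Proof.
move=> T bT; set Y := pullback_range R cK cL phi_cont phi_onto in T bT *.
have onto l : exists x, phi x = l.
  by have [x _ <-] := phi_onto l I; exists x.
have zL := scattered_zero_dimensional cL hL sL.
have pbY (h : Cspace R cL) : pullback cK phi_cont h \in Y.
  by apply: mem_set; exists h.
pose inY (h : Cspace R cL) : subspace_of Y := exist (fun f => f \in Y) _ (pbY h).
pose Th (h : Cspace R cL) : c0space R := T (inY h).
have tau0 : 0 <= opnorm T.
  have [M TM] := bT 1; apply: (@le_trans _ _ `|T 0|) => //.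
  apply: ub_le_sup; first by exists M => _ [y y1 <-]; exact: TM.
  by exists 0 => //=; rewrite normr0.
pose mu n (h : Cspace R cL) : R := c0_seq (Th h) n.
have lmu n : functional (mu n).
  move=> a u v; rewrite /mu /Th.
  have -> : inY (a *: u + v) = a *: inY u + inY v.
    by apply: val_inj; exact: CspaceP.
  by rewrite linearP.
have bmu n h : `|mu n h| <= opnorm T * `|h|.
  apply: le_trans (supnorm_ub n (c0_bdd (Th h))) _.
  apply: le_trans (opnorm_bound _ bT) _; rewrite ler_wpM2l//.
  apply: (@supnorm_le R K _ `|h|) => // x; exact: (Cfun_le h (phi x)).
have mu0 h : mu^~ h @ \oo --> (0 : R) by have /asboolP := c0_seqP (Th h).
have [nu [lnu xnu nu0 bnu]] : exists nu : nat -> Cspace R cK -> R,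
  [/\ forall n, functional (nu n),
   forall n (h : Cspace R cL), nu n (pullback cK phi_cont h) = mu n h,
   forall f, nu^~ f @ \oo --> (0 : R)
   & forall n f, `|nu n f| <= (2 + eps) * opnorm T * `|f| ].
  (* e = eps * opnorm T has to be positive, hence the case T = 0. *)
  have [t0|tn0] := eqVneq (opnorm T) 0.
    exists (fun _ _ => 0); split.
    - by move=> n a u v; rewrite mulr0 addr0.
    - by move=> n h; apply/esym/eqP; rewrite -normr_le0 (le_trans (bmu n h))// t0 mul0r.
    - by move=> f; exact: cvg_cst.
    - by move=> n f; rewrite normr0 t0 mulr0 mul0r.
  have /choice[m mP] := fun n =>
    functional_extension cK hL zL phi_cont onto tau0 (lmu n) (bmu n).
  have lm n : functional (m n) by case: (mP n).
  have bm n f : `|m n f| <= opnorm T * `|f| by case: (mP n).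
  have xm n (h : Cspace R cL) :
      m n (restr_over phi [set: L] (pullback cK phi_cont h)) = mu n h.
    by rewrite /restr_over preimage_setT restrT; case: (mP n).
  have e0 : 0 < eps * opnorm T by rewrite mulr_gt0// lt_neqAle eq_sym tn0.
  have [h|nu [lnu xnu nu0 bnu]] :=
    @extendable_scattered R d K L cK cL hL phi phi_cont onto pL sL
      m (opnorm T) tau0 lm bm _ _ e0.
    by under eq_fun do rewrite xm; exact: mu0.
  exists nu; split => // [n h|n f]; first by rewrite xnu xm.
  apply: le_trans (bnu n f `|f| (normr_ge0 _) (fun x _ => Cfun_le f x)) _.
  rewrite ler_wpM2r// [leRHS]mulrDl lerD2r ler_wpM2l//.
  exact: (local_norm_le tau0).
have inc0 f : (fun n => nu n f) \in @null_seq R by apply/asboolP; exact: nu0.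
pose T'0 (f : Cspace R cK) : c0space R := C0Seq (inc0 f).
have lT' : linear T'0.
  by move=> a u v; apply: val_inj; apply/funext => n; exact: lnu.
pose T' : {linear Cspace R cK -> c0space R} :=
  HB.pack T'0 (GRing.isLinear.Build R (Cspace R cK) (c0space R) _ T'0 lT').
have T'B f : `|T' f| <= (2 + eps) * opnorm T * `|f|.
  apply: (@supnorm_le R nat) => [|n]; last exact: bnu.
  by rewrite !mulr_ge0// addr_ge0// ltW.
exists T'; split.
- move=> r; exists ((2 + eps) * opnorm T * r) => f fr.
  by rewrite (le_trans (T'B f))// ler_wpM2l// mulr_ge0// addr_ge0// ltW.
- move=> y; apply: val_inj; apply/funext => n.
  have /set_mem[h _ hy] := valP y.
  have -> : T y = Th h by congr (T _); apply: val_inj.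
  by rewrite -hy; exact: xnu.
- apply: ge_sup; first by exists `|T' 0|; exists 0 => //=; rewrite normr0.
  move=> _ [f /= f1 <-]; rewrite (le_trans (T'B f))// ler_piMr//.
  by rewrite mulr_ge0// addr_ge0// ltW.
Qed.
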